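(* Let $d,m\in\mathbb{N}$, $T,\kappa\in[0,\infty)$, $\alpha\in[0,2)$, $\mu\in C^1(\mathbb{R}^d,\mathbb{R}^d)$, $\sigma\in\mathbb{R}^{d\times m}$, $V\in C^1(\mathbb{R}^d,[0,\infty))$, let $\|\cdot\|\colon\mathbb{R}^d\to[0,\infty)$ and $\|\cdot\|_*\colon\mathbb{R}^m\to[0,\infty)$ be norms, assume for all $x,h\in\mathbb{R}^d$, $z\in\mathbb{R}^m$ that $$\|\mu'(x)h\|\leq \kappa(1+\|x\|^\kappa)\|h\|,\qquad V'(x)\mu(x+\sigma z)\leq \kappa(1+\|z\|_*^\alpha)V(x),\qquad \|x\|\leq V(x),$$ let $(\Omega,\mathcal{F},\mathbb{P})$ be a probability space, and let $W\colon[0,T]\times\Omega\to\mathbb{R}^m$ be a standard Brownian motion with continuous sample paths. Then (i) there exist unique stochastic processes $X^x\colon[0,T]\times\Omega\to\mathbb{R}^d$, $x\in\mathbb{R}^d$, with continuous sample paths such that for all $x\in\mathbb{R}^d$, $t\in[0,T]$, $\omega\in\Omega$ it holds that $$X^x(t,\omega)=x+\int_0^t\mu(X^x(s,\omega))\,\mathrm{d}s+\sigma W(t,\omega),$$ and (ii) for all $R,q\in[0,\infty)$ there exists $c\in(0,\infty)$ such that for all $x,y\in\{v\in\mathbb{R}^d\colon\|v\|\leq R\}$ with $0<\|x-y\|\neq 1$ it holds that $$\sup_{t\in[0,T]}\mathbb{E}\bigl[\|X^x(t)-X^y(t)\|\bigr]\leq c\,\bigl|\ln(\|x-y\|)\b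igr|^{-q}.$$
   Context: $\mathbb{N}=\{1,2,3,\dots\}$. $\mu'(x)$ and $V'(x)$ denote the (Fréchet) derivatives of $\mu$ and $V$ at $x$, so that $\mu'(x)h\in\mathbb{R}^d$ and $V'(x)\mu(x+\sigma z)\in\mathbb{R}$ is the derivative of $V$ at $x$ in direction $\mu(x+\sigma z)$. ''Continuous sample paths'' means that for every $\omega\in\Omega$ the path is continuous on $[0,T]$. $X^x(t)$ denotes the random variable $\omega\mapsto X^x(t,\omega)$. The convention $0^0=1$ is used for powers. *)

(* Defs.v *)
From HB Require Import structures.
From mathcomp Require Import all_boot all_order all_algebra.
From mathcomp Require Import all_classical all_reals all_analysis.

Set Implicit Arguments.
Unset Strict Implicit.
Unset Printing Implicit Defensive.

Import Order.TTheory GRing.Theory Num.Theory.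
Import numFieldNormedType.Exports.

Local Open Scope classical_set_scope.
Local Open Scope ring_scope.

Record is_norm (R : realType) (E : lmodType R) (N : E -> R) : Prop := IsNorm {
  is_norm_ge0 : forall x, 0 <= N x;
  is_norm_eq0 : forall x, N x = 0 -> x = 0;
  is_normZ : forall (a : R) x, N (a *: x) = `|a| * N x;
  is_normD : forall x y, N (x + y) <= N x + N y }.

(* The second clause is continuity of x |-> 'd f x for the operator norm. *)
Definition C1 (R : realType) (U V : normedModType R) (f : U -> V) : Prop :=
  (forall x, differentiable f x) /\
  (forall x (e : R), 0 < e ->
     \forall y \near x, forall h, `|'d f y h - 'd f x h| <= e * `|h|).

(* Column vectors equipped with their Borel sigma-algebra (mathcomp-analysis
   has no measurable structure on matrices). *)
Definition borelV (R : realType) (n : nat) :=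
  g_sigma_algebraType (@open 'cV[R]_n).

Section processes.
Context {R : realType} {dO : measure_display} {Omega : measurableType dO}.
Variable P : probability Omega R.

Definition random_vector (n : nat) (X : Omega -> 'cV[R]_n) : Prop :=
  measurable_fun [set: Omega] (X : Omega -> borelV R n).

(* Mutual independence of a finite family; taking some of the B k to be the
   whole space gives the product rule for subfamilies. *)
Definition independent_vectors (n k : nat)
    (X : 'I_k -> Omega -> 'cV[R]_n) : Prop :=
  forall B : 'I_k -> set (borelV R n), (forall i, measurable (B i)) ->
    P [set w | forall i, B i (X i w)] =
    (\prod_(i < k) P [set w | B i (X i w)])%E.

(* X has law N(0, v I_n), i.e. the n-fold product of N(0, v). The second
   argument of normal_prob is the standard deviation, which must be nonzero
   (the library gives a junk law for 0), so this is only meant for v > 0. *)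
Definition centered_normal (n : nat) (X : Omega -> 'cV[R]_n) (v : R) : Prop :=
  forall A : 'I_n -> set R, (forall j, measurable (A j)) ->
    P [set w | forall j, A j (X w j ord0)] =
    (\prod_(j < n) normal_prob 0 (Num.sqrt v) (A j))%E.

(* Processes indexed by [0, T] are represented by functions of t : R whose
   values outside [0, T] are ignored. *)
Definition stochastic_process (n : nat) (T : R)
    (X : R -> Omega -> 'cV[R]_n) : Prop :=
  forall t, t \in `[0, T] -> random_vector (X t).

Definition continuous_paths (n : nat) (T : R)
    (X : R -> Omega -> 'cV[R]_n) : Prop :=
  forall w, {within `[0, T], continuous (fun t => X t w)}.

Record brownian_motion (n : nat) (T : R) (W : R -> Omega -> 'cV[R]_n) :
    Prop := BrownianMotion {
  bm_process : stochastic_process T W;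
  bm_start : {ae P, forall w, W 0 w = 0};
  bm_indep : forall (k : nat) (t : nat -> R),
    (forall i, (i <= k)%N -> t i \in `[0, T]) ->
    (forall i, (i < k)%N -> t i <= t i.+1) ->
    independent_vectors (fun (i : 'I_k) w => W (t i.+1) w - W (t i) w);
  bm_normal : forall s t, 0 <= s -> s < t -> t <= T ->
    centered_normal (fun w => W t w - W s w) (t - s) }.

(* X solves dX = mu(X) dt + sigma dW on [0, T] with X(0) = x + sigma W(0),
   pathwise; the vector-valued integral is taken componentwise. *)
Record sde_solution (d m : nat) (T : R) (mu : 'cV[R]_d -> 'cV[R]_d)
    (sigma : 'M[R]_(d, m)) (W : R -> Omega -> 'cV[R]_m) (x : 'cV[R]_d)
    (X : R -> Omega -> 'cV[R]_d) : Prop := SdeSolution {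
  sol_process : stochastic_process T X;
  sol_paths : continuous_paths T X;
  sol_eq : forall t w, t \in `[0, T] ->
    X t w = x
      + \col_i (\int[lebesgue_measure]_(s in `[0, t]) (mu (X s w)) i ord0)
      + sigma *m W t w }.

End processes.

(* Main.v *)
Require Import Defs.
From HB Require Import structures.
From mathcomp Require Import all_boot all_order all_algebra.
From mathcomp Require Import all_classical all_reals all_analysis.
From mathcomp Require Import measurable_realfun lra ring.

Set Implicit Arguments.
Unset Strict Implicit.
Unset Printing Implicit Defensive.

Import Order.TTheory GRing.Theory Num.Theory.
Import numFieldNormedType.Exports.

Local Open Scope classical_set_scope.
Local Open Scope ring_scope.

(** Writing [X = Y + g] with [g t = sigma W t], the equation becomes, for each fixed
path, the ordinary differential equation [Y' = mu (Y + g)].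

Existence and uniqueness. As [mu] has a locally bounded derivative it is Lipschitz on
balls, so that uniqueness and stability follow from Gronwall's inequality
([solves_unique], [solves_stability]). For existence the drift is multiplied by a cutoff
function with values in [0, 1] and becomes globally Lipschitz, so that Picard iteration
converges ([picard_limit]). The hypothesis on [V] says that [V (Y t)] grows at most at
rate [kappa (1 + |W t|^alpha)], and multiplying the drift by a cutoff preserves this
([curve_lyapunov]). Since the norm is dominated by [V], the solution of the equation with
cut off drift stays in a ball that does not depend on the cutoff, and for a large cutoff
radius it solves the original equation ([cut_curve_solves]). The solution is thus a limit
of limits of Picard iterates. These are measurable because integrals over time are limits
of Riemann sums ([measurable_primitive]), and therefore so is the solution.

The modulus of continuity. Let [s] be the maximum of [|W|] over [0, T]. Up to constants,
all solutions started in a ball are bounded by [M = exp (A (1 + s + s^alpha))], and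
Gronwall's inequality gives [|X^x t - X^y t| <= c dl exp (K M^kappa)] with
[dl = |x - y|]. With [l = |ln dl|], either [l] exceeds twice the exponent, and the
difference is at most [exp (- l / 2)], which beats every power of [l]; or [l] is at most a
multiple of [M^kappa]. In both cases [l^q |X^x t - X^y t|] is at most a constant times
[M^(kappa q + 1)] ([log_tradeoff], [log_modulus]). Because [alpha < 2], this is dominated
by a constant times [exp (eps s^2)] for any [eps > 0] ([growth_pow_le]), and it remains to
find one [eps] for which [exp (eps s^2)] is integrable ([brownian_exp_moment]).

The last point is a chaining argument. If [s > 1], then some dyadic increment of level
[k] exceeds [s] times the weight [(3/4)^k / 8], for otherwise summing over the levels would
give [s <= s / 2] ([chaining_le]). So [exp (eps s^2)] is bounded by [exp eps] plus the sum,
over all dyadic increments [D] of level [k] with [y = D / ((3/4)^k / 8)], of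
[y^14 exp (eps y^2)], and the expectations of the sums over the levels decay geometrically
([chain_fun_expectation], [chain_sum_expectation]). *)

(** * One-variable calculus on a time interval *)

Section calculus.
Context {R : realType}.
Implicit Types (f g F G : R -> R) (a b t A T : R).

(** Composing with the clamp turns a function that is continuous on [[0, T]] into one
that is continuous everywhere, and leaves it unchanged on [[0, T]]. *)
Definition time_clamp T t := Num.max 0 (Num.min t T).

Lemma time_clamp_in T t : 0 <= T -> time_clamp T t \in `[0, T].
Proof.
move=> T0; rewrite in_itv/= /time_clamp le_max lexx/= ge_max T0/=.
by rewrite ge_min lexx orbT.
Qed.

Lemma time_clamp_id T t : t \in `[0, T] -> time_clamp T t = t.
Proof.
by rewrite in_itv/= => /andP[t0 tT]; rewrite /time_clamp (min_idPl tT) (max_idPr t0).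
Qed.

Lemma continuous_time_clamp T : continuous (time_clamp T).
Proof.
move=> t; rewrite /time_clamp.
apply: (@continuous_max _ _ (fun=> 0) (fun t => Num.min t T)); first exact: cvg_cst.
by apply: (@continuous_min _ _ (fun t => t) (fun=> T)); [exact: cvg_id | exact: cvg_cst].
Qed.

Lemma continuous_comp_time_clamp (U : topologicalType) T (f : R -> U) : 0 <= T ->
  {within `[0, T], continuous f} -> continuous (f \o time_clamp T).
Proof.
move=> T0 cf t.
have tT : `[0, T]%classic (time_clamp T t) by exact: time_clamp_in.
move=> B /cf; rewrite /nbhs/= -(nbhs_subspace_in tT) => nB.
have := @continuous_time_clamp T t _ nB.
by apply: (@filterS _ (nbhs t)) => s /=; apply; exact: time_clamp_in.
Qed.

Lemma nondecreasing_of_derive F F' a b : a <= b ->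
  {within `[a, b], continuous F} ->
  (forall t, t \in `]a, b[ -> is_derive t 1 F (F' t)) ->
  (forall t, t \in `]a, b[ -> 0 <= F' t) -> F a <= F b.
Proof.
move=> ab cF dF F'0.
have [c cab e] := MVT_segment ab dF cF.
move: ab; rewrite le_eqVlt => /predU1P[->//|ab].
have [{}c {}cab {}e] := MVT ab dF cF.
by rewrite -subr_ge0 e mulr_ge0 ?F'0// subr_ge0 ltW.
Qed.

(** Applied to primitives, this estimates integrals by way of derivatives only, so
that no integrability has to be tracked. *)
Lemma increment_le F F' G G' a b : a <= b ->
  {within `[a, b], continuous F} -> {within `[a, b], continuous G} ->
  (forall t, t \in `]a, b[ -> is_derive t 1 F (F' t)) ->
  (forall t, t \in `]a, b[ -> is_derive t 1 G (G' t)) ->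
  (forall t, t \in `]a, b[ -> `|F' t| <= G' t) -> `|F b - F a| <= G b - G a.
Proof.
move=> ab cF cG dF dG FG; rewrite ler_norml; apply/andP; split.
  suff : (F \+ G) a <= (F \+ G) b by rewrite /=; lra.
  apply: (@nondecreasing_of_derive _ (F' \+ G')) => //.
  - by move=> t; apply: continuousD; [exact: cF | exact: cG].
  - by move=> t tab; apply: is_deriveD; [exact: dF | exact: dG].
  - by move=> t tab /=; have := FG _ tab; rewrite ler_norml; lra.
suff : (G \- F) a <= (G \- F) b by rewrite /=; lra.
apply: (@nondecreasing_of_derive _ (G' \- F')) => //.
- by move=> t; apply: continuousB; [exact: cG | exact: cF].
- by move=> t tab; apply: is_deriveB; [exact: dG | exact: dF].
- by move=> t tab /=; have := FG _ tab; rewrite ler_norml; lra.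
Qed.

(** [F t * exp (- A t)] has a nonpositive derivative. *)
Lemma gronwall F F' A T :
  {within `[0, T], continuous F} ->
  (forall t, t \in `]0, T[ -> is_derive t 1 F (F' t)) ->
  (forall t, t \in `]0, T[ -> F' t <= A * F t) ->
  forall t, t \in `[0, T] -> F t <= F 0 * expR (A * t).
Proof.
move=> cF dF F'A t tT; have := tT; rewrite in_itv/= => /andP[t0 tT'].
have sub : {subset `]0, t[ <= `]0, T[}.
  by move=> s; rewrite !in_itv/= => /andP[-> /lt_le_trans]; apply.
have eD (s : R) : is_derive s 1 (fun s => - expR (- A * s)) (A * expR (- A * s)).
  have := @is_deriveN _ _ _ (fun s => expR (- A * s)) s 1 (- A * expR (- A * s)).
  rewrite mulNr opprK; apply.
  have h : is_derive s 1 ( *%R (- A)) (- A).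
    by have := @is_deriveZ _ _ _ id (- A) s 1 1 _; rewrite scaler1; apply.
  have := @is_derive1_comp _ expR ( *%R (- A)) s _ _ (is_derive_expR (- A * s)) h.
  by rewrite mulrN [_ * A]mulrC.
pose H s := F s * - expR (- A * s).
suff : H 0 <= H t.
  rewrite /H mulr0 expR0 !mulrN mulr1 lerNl opprK mulNr.
  by rewrite expRN ler_pdivrMr ?expR_gt0.
apply: (@nondecreasing_of_derive H
   (fun s => F s *: (A * expR (- A * s)) + (- expR (- A * s)) *: F' s)) => //.
- move=> s; apply: (@continuousM R _ (F : subspace `[0, t] -> R)
      (fun s => - expR (- A * s))).
    apply: continuous_subspaceW cF s.
    by move=> s; rewrite /= !in_itv/= => /andP[-> /le_trans]; apply.
  apply: continuous_subspaceT => {}s.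
  by have /@ex_derive/derivable1_diffP/differentiable_continuous := eD s.
- move=> s st; apply: is_deriveM; exact: dF (sub _ st).
- move=> s st; rewrite /GRing.scale/=.
  have := F'A _ (sub _ st); have := expR_gt0 (- A * s).
  move: (expR _) => e e0 h; rewrite mulNr subr_ge0 [leRHS]mulrCA mulrA.
  by rewrite [leLHS]mulrC ler_pM2r ?mulrA// mulrC.
Qed.

(** Near-coverings give the uniform modulus: each point has a neighbourhood on which
one small enough [dt] works, and compactness makes [dt] uniform. *)
Lemma heine f a b e : continuous f -> 0 < e ->
  exists2 dt, 0 < dt & forall s t, s \in `[a, b] -> `|s - t| <= dt -> `|f s - f t| <= e.
Proof.
move=> cf e0.
have := @segment_compact _ a b => /compact_near_coveringP.
move=> /(_ _ (at_right (0:R)) (fun d s => forall t, `|s - t| <= d -> `|f s - f t| <= e)).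
have e20 : 0 < e / 2 by lra.
case.
  move=> s _; have /cvgrPdist_le/(_ _ e20) := cf s.
  rewrite near_simpl => -[d /= d0 H].
  exists (ball s (d/2), [set x | x < d / 2]) => /=.
    split; first by apply: nbhsx_ballx; lra.
    by apply: nbhs_right_lt; lra.
  move=> -[s' x] /= [] h1 h2 t h3.
  have A1 : `|f s - f s'| <= e / 2.
    by apply: H; apply: lt_trans h1 _; lra.
  have A2 : `|f s - f t| <= e / 2.
    apply: H => /=; have -> : s - t = (s - s') + (s' - t) by lra.
    by apply: le_lt_trans (ler_normD _ _) _; rewrite /ball/= in h1; lra.
  rewrite (_ : _ - _ = (f s - f t) - (f s - f s')); last by lra.
  by apply: le_trans (ler_normB _ _) _; lra.
move=> d /= d0 H.
exists (d / 2); first by lra.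
move=> s t sab; apply: (H (d/2)) => //=; last by lra.
by rewrite sub0r normrN gtr0_norm; lra.
Qed.


Definition primitive f t := (\int[lebesgue_measure]_(s in `[0, t]) f s)%R.

Lemma continuous_itv_integrable f a b : continuous f ->
  lebesgue_measure.-integrable `[a, b] (EFin \o f).
Proof.
move=> cf; apply: continuous_compact_integrable; first exact: segment_compact.
exact: continuous_subspaceT.
Qed.

Lemma primitive0 f : primitive f 0 = 0.
Proof. by rewrite /primitive set_itv1 Rintegral_set1. Qed.

Lemma eq_primitive f g t : {in `[0, t], f =1 g} -> primitive f t = primitive g t.
Proof. by move=> fg; apply: eq_Rintegral => s; rewrite inE; exact: fg. Qed.

Lemma primitive_continuous f T : 0 <= T -> continuous f ->
  {within `[0, T], continuous (primitive f)}.
Proof.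
by move=> T0 cf; apply: parameterized_integral_continuous => //; exact: continuous_itv_integrable.
Qed.

Lemma primitive_is_derive f t : continuous f -> 0 < t ->
  is_derive t 1 (primitive f) (f t).
Proof.
move=> cf t0.
have [||] := @continuous_FTC1_closed R f 0 t (t + 1) _ (continuous_itv_integrable _ _ cf) t0.
- by rewrite ltrDl.
- exact: cf.
move=> h1 h2; apply: DeriveDef; first exact: h1.
by rewrite -derive1E; exact: h2.
Qed.

(** The mean value theorem on each cell turns Heine's theorem into convergence
of the Riemann sums. *)
Lemma riemann_sum_cvg f t : continuous f -> 0 <= t ->
  \sum_(k < n.+1) (t / n.+1%:R) * f (k%:R * (t / n.+1%:R)) @[n --> \oo]
   --> primitive f t.
Proof.
move=> cf t0; apply/cvgrPdist_le => e e0.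
have e'0 : 0 < e / (t + 1) by rewrite divr_gt0//; lra.
have [dt dt0 Hdt] := @heine f 0 t _ cf e'0.
near=> n.
set h := t / n.+1%:R.
have n0 : 0 < n.+1%:R :> R by rewrite ltr0n.
have hdt : h <= dt.
  rewrite ler_pdivrMr// -ler_pdivrMl//.
  apply: (@le_trans _ _ n%:R); last by rewrite ler_nat.
  near: n; exact: nbhs_infty_ger.
have h0 : 0 <= h by rewrite divr_ge0// ltW.
have hk k : k%:R * h <= k.+1%:R * h by rewrite ler_wpM2r// ler_nat.
have hn : n.+1%:R * h = t by rewrite mulrC divfK// gt_eqF.
have hT k : (k <= n.+1)%N -> k%:R * h \in `[0, t].
  by move=> kn; rewrite in_itv/= mulr_ge0//= -hn ler_wpM2r// ler_nat.
have cell k : (k <= n)%N ->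
    `|primitive f (k.+1%:R * h) - primitive f (k%:R * h) - h * f (k%:R * h)| <= h * (e / (t + 1)).
  move=> kn.
  have [||c cin ->] := @MVT_segment R (primitive f) f _ _ (hk k).
  - move=> s; rewrite in_itv/= => /andP[s1 _]; apply: primitive_is_derive => //.
    by apply: le_lt_trans s1; rewrite mulr_ge0.
  - apply: continuous_subspaceW (primitive_continuous t0 cf) => s.
    rewrite /= !in_itv/= => /andP[s1 s2]; apply/andP; split.
      by apply: le_trans s1; rewrite mulr_ge0.
    by apply: le_trans s2 _; have := hT k.+1 kn; rewrite in_itv/= => /andP[].
  have -> : k.+1%:R * h - k%:R * h = h by rewrite -natr1; lra.
  rewrite [f c * h]mulrC -mulrBr normrM (ger0_norm h0) ler_wpM2l// distrC Hdt//.
    by apply: hT; exact: leqW.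
  move: cin; rewrite in_itv/= -natr1 => cin; rewrite ler_norml; lra.
have -> : primitive f t = \sum_(k < n.+1) (primitive f (k.+1%:R * h) - primitive f (k%:R * h)).
  rewrite -(big_mkord xpredT (fun k => primitive f (k.+1%:R * h) - primitive f (k%:R * h))).
  by rewrite (telescope_sumr (fun k => primitive f (k%:R * h)))// hn mul0r primitive0 subr0.
rewrite -sumrB; apply: le_trans (ler_norm_sum _ _ _) _.
apply: (@le_trans _ _ (\sum_(k < n.+1) h * (e / (t + 1)))).
  by apply: ler_sum => k _; apply: cell; rewrite -ltnS.
rewrite sumr_const card_ord -mulr_natl mulrA hn mulrCA -[leRHS]mulr1 ler_wpM2l//.
  exact: ltW.
by rewrite ler_pdivrMr; lra.
Unshelve. all: end_near. Qed.

End calculus.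

(** * Column vectors: norms, curves, compactness *)

Section vectors.
Context {R : realType}.

Lemma continuous_of_locally_lipschitz (U V : normedModType R) (f : U -> V) :
  (forall x, exists2 C, 0 < C & forall y, `|x - y| <= 1 -> `|f x - f y| <= C * `|x - y|) ->
  continuous f.
Proof.
move=> fC x; have [C C0 {}fC] := fC x; apply/cvgrPdist_le => e e0.
near=> y; have xy1 : `|x - y| <= 1.
  near: y; apply: cvgr_dist_le; [exact: cvg_id | exact: ltr01].
have : `|x - y| <= e / C.
  near: y; apply: cvgr_dist_le; [exact: cvg_id | by rewrite divr_gt0].
by rewrite ler_pdivlMr// mulrC => h; apply: le_trans (fC _ xy1) h.
Unshelve. all: end_near. Qed.

Lemma continuous_of_lipschitz (U V : normedModType R) (f : U -> V) (C : R) : 0 < C ->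
  (forall x y, `|f x - f y| <= C * `|x - y|) -> continuous f.
Proof.
by move=> C0 fC; apply: continuous_of_locally_lipschitz => x; exists C.
Qed.

Lemma cV_coord_le n (x : 'cV[R]_n) i j : `|x i j| <= `|x|.
Proof. by rewrite [leRHS]/Num.Def.normr/= mx_normrE; exact: (le_bigmax _ _ (i, j)). Qed.

Lemma cV_norm_le n (x : 'cV[R]_n) M : 0 <= M -> (forall i, `|x i ord0| <= M) -> `|x| <= M.
Proof.
move=> M0 xM; rewrite [leLHS]/Num.Def.normr/= mx_normrE.
by apply: bigmax_le => // -[i j] _ /=; rewrite (ord1 j).
Qed.

Lemma cV_cvg (T : Type) (F : set_system T) {FF : Filter F} n (f : T -> 'cV[R]_n) (l : 'cV[R]_n) :
  (forall i, f x i ord0 @[x --> F] --> l i ord0) -> f x @[x --> F] --> l.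
Proof.
move=> fl; apply/cvgrPdist_le => e e0; near=> x.
apply: cV_norm_le; first exact: ltW.
move=> i; rewrite !mxE; move: i; near: x; apply: filter_forall => i.
exact: ((cvgrPdist_le _ _).1 (fl i)).
Unshelve. all: end_near. Qed.

Lemma cV_cvg_coord (T : Type) (F : set_system T) {FF : Filter F} n (f : T -> 'cV[R]_n) (l : 'cV[R]_n) i :
  f x @[x --> F] --> l -> f x i ord0 @[x --> F] --> l i ord0.
Proof.
move=> fl; apply/cvgrPdist_le => e e0.
have /cvgrPdist_le/(_ e e0) := fl; apply: filterS => x; apply: le_trans.
by have := cV_coord_le (l - f x) i ord0; rewrite !mxE.
Qed.

Lemma continuous_cV (T : topologicalType) n (f : T -> 'cV[R]_n) :
  (forall i, continuous (fun x => f x i ord0)) -> continuous f.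
Proof. by move=> cf x; apply: cV_cvg => i; exact: cf. Qed.

Lemma continuous_cV_coord (T : topologicalType) n (f : T -> 'cV[R]_n) i :
  continuous f -> continuous (fun x => f x i ord0).
Proof.
move=> cf x; apply: (@continuous_comp _ _ _ f (fun v : 'cV[R]_n => v i ord0)).
  exact: cf.
exact: coord_continuous.
Qed.

Lemma is_derive_coord n (u : R -> 'cV[R]_n) (t : R) v i :
  is_derive t (1 : R) u v -> is_derive t (1 : R) (fun s => u s i ord0) (v i ord0).
Proof.
move=> [du <-]; apply: DeriveDef; first exact: (derivable_mxP _ _ _).1.
by rewrite derive_mx// mxE.
Qed.

Lemma is_derive_cV n (u : R -> 'cV[R]_n) (t : R) (v : 'cV[R]_n) :
  (forall i, is_derive t (1 : R) (fun s => u s i ord0) (v i ord0)) -> is_derive t (1 : R) u v.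
Proof.
move=> du; have ud : derivable u t 1.
  by apply/derivable_mxP => i j; rewrite (ord1 j); exact: (@ex_derive _ _ _ _ _ _ _ (du i)).
apply: DeriveDef => //; rewrite derive_mx//; apply/matrixP => i j.
by rewrite mxE (ord1 j); exact: (@derive_val _ _ _ _ _ _ _ (du i)).
Qed.

Lemma is_derive_diff_comp (U V : normedModType R) (u : R -> U) (F : U -> V) (t : R) v :
  is_derive t (1 : R) u v -> differentiable F (u t) -> is_derive t (1 : R) (F \o u) ('d F (u t) v).
Proof.
move=> [du uv] dF.
have du' : differentiable u t by exact/derivable1_diffP.
have dFu : differentiable (F \o u) t by exact: differentiable_comp.
apply: DeriveDef; first exact/derivable1_diffP.
by rewrite deriveE// diff_comp//= -uv deriveE.
Qed.

(** Transposition transports the Heine-Borel theorem from row vectors. *)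
Lemma cV_bounded_closed_compact n (A : set 'cV[R]_n) M :
  closed A -> (forall x, A x -> `|x| <= M) -> compact A.
Proof.
move=> cA AM.
have ct : continuous (trmx : 'rV[R]_n -> 'cV[R]_n).
  apply: continuous_cV => i; rewrite (_ : (fun _ => _) = (fun x : 'rV[R]_n => x ord0 i)).
    exact: coord_continuous.
  by apply/funext => x; rewrite mxE.
rewrite (_ : A = trmx @` [set x : 'rV[R]_n | A x^T]).
  apply: continuous_compact; first exact: continuous_subspaceT.
  apply: bounded_closed_compact.
    exists M; split; first exact: num_real.
    move=> r Mr x /= /AM xM; apply: le_trans (ltW Mr); apply: le_trans xM.
    rewrite [leLHS]/Num.Def.normr/= mx_normrE; apply: bigmax_le => // -[i j] _ /=.
    by rewrite (ord1 i); have := cV_coord_le x^T j ord0; rewrite mxE.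
  by apply: (@closed_comp _ _ (trmx : 'rV[R]_n -> 'cV[R]_n)) => // x _; exact: ct.
apply/seteqP; split => [x Ax|x [y Ay <-]//].
by exists x^T => /=; rewrite trmxK.
Qed.

Lemma continuous_bounded_on_ball n (f : 'cV[R]_n -> R) M : continuous f ->
  exists2 K, 0 <= K & forall x, `|x| <= M -> `|f x| <= K.
Proof.
move=> cf.
have cB : compact [set x : 'cV[R]_n | `|x| <= M].
  apply: (@cV_bounded_closed_compact _ _ M) => //.
  apply: (@closed_comp _ _ (fun x : 'cV[R]_n => `|x|) [set x | x <= M]).
    by move=> x _; exact: norm_continuous.
  exact: closed_le.
have [|B0] := pselect ([set x : 'cV[R]_n | `|x| <= M] !=set0); last first.
  by exists 0 => // x xM; exfalso; apply: B0; exists x.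
move=> B0.
have cf' : {within [set x : 'cV[R]_n | `|x| <= M], continuous (fun x => `|f x|)}.
  apply: continuous_subspaceT => x; apply: continuous_comp; first exact: cf.
  exact: norm_continuous.
have [c _ H] := compact_EVT_max B0 cB cf'.
by exists `|f c| => // x xM; apply: H; rewrite inE.
Qed.

End vectors.

Section norms.
Context {R : realType} {n : nat}.
Variable N : 'cV[R]_n -> R.
Hypothesis hN : is_norm N.

Lemma is_norm0 : N 0 = 0.
Proof. by rewrite -(scale0r (0 : 'cV[R]_n)) (is_normZ hN) normr0 mul0r. Qed.

Lemma is_normN x : N (- x) = N x.
Proof. by rewrite -scaleN1r (is_normZ hN) normrN1 mul1r. Qed.

Lemma is_norm_sum I (r : seq I) (F : I -> 'cV[R]_n) :
  N (\sum_(i <- r) F i) <= \sum_(i <- r) N (F i).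
Proof.
elim/big_ind2 : _ => // [|x a y b xa yb]; first by rewrite is_norm0.
by apply: le_trans (is_normD hN _ _) _; exact: lerD.
Qed.

Lemma is_norm_le_sup : exists2 C, 0 < C & forall x, N x <= C * `|x|.
Proof.
exists (1 + \sum_(i < n) N (delta_mx i ord0)).
  by apply: ltr_wpDr => //; apply: sumr_ge0 => i _; exact: (is_norm_ge0 hN).
move=> x; rewrite {1}(matrix_sum_delta x).
under eq_bigr do rewrite big_ord1.
apply: le_trans (is_norm_sum _ _) _.
apply: (@le_trans _ _ (\sum_(i < n) N (delta_mx i ord0) * `|x|)).
  apply: ler_sum => i _; rewrite (is_normZ hN) mulrC ler_wpM2l//.
    exact: (is_norm_ge0 hN).
  exact: cV_coord_le.
by rewrite -mulr_suml ler_wpM2r// lerDr.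
Qed.

Lemma is_norm_continuous : continuous N.
Proof.
have [C C0 NC] := is_norm_le_sup.
apply: (@continuous_of_lipschitz _ _ _ _ C) => // x y.
have := is_normD hN (x - y) y; have := is_normD hN (y - x) x.
have := NC (x - y); have := NC (y - x).
rewrite !subrK -(opprB x y) is_normN normrN ler_norml; lra.
Qed.

(** On the unit sphere of the sup norm, which is compact, [N] has a positive
minimum. *)
Lemma is_norm_ge_sup : exists2 C, 0 < C & forall x, `|x| <= C * N x.
Proof.
pose S := [set x : 'cV[R]_n | `|x| = 1].
have [S0|S0] := pselect (S !=set0); last first.
  exists 1 => // x; have [->|x0] := eqVneq x 0; first by rewrite normr0 is_norm0 mulr0.
  by exfalso; apply: S0; exists (`|x|^-1 *: x); rewrite /S/= normrZV// unitfE normr_eq0.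
have cS : compact S.
  apply: (@cV_bounded_closed_compact _ _ _ 1); last by move=> x ->.
  apply: (@closed_comp _ _ (fun x : 'cV[R]_n => `|x|) [set 1]).
    by move=> x _; exact: norm_continuous.
  exact: closed_eq.
have [c cS' H] := compact_EVT_min S0 cS (continuous_subspaceT is_norm_continuous).
have Nc : 0 < N c.
  rewrite lt_neqAle (is_norm_ge0 hN) andbT; apply/eqP => /esym/(is_norm_eq0 hN) c0.
  by move: cS'; rewrite inE /S/= c0 normr0 => /esym/eqP; rewrite oner_eq0.
exists (N c)^-1; first by rewrite invr_gt0.
move=> x; have [->|x0] := eqVneq x 0; first by rewrite normr0 is_norm0 mulr0.
have xn : 0 < `|x| by rewrite normr_gt0.
rewrite ler_pdivlMl//.
have : N c <= N (`|x|^-1 *: x).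
  by apply: H; rewrite inE /S/= normrZV// unitfE gt_eqF.
by rewrite (is_normZ hN) gtr0_norm ?invr_gt0// ler_pdivlMl// mulrC.
Qed.

End norms.

Section linear_and_lipschitz.
Context {R : realType}.

Lemma mulmx_cV_bounded n m (A : 'M[R]_(n, m)) :
  exists2 C, 0 < C & forall z : 'cV[R]_m, `|A *m z| <= C * `|z|.
Proof.
exists (1 + \sum_i \sum_j `|A i j|).
  by apply: ltr_wpDr => //; apply: sumr_ge0 => i _; apply: sumr_ge0.
move=> z; apply: cV_norm_le.
  by rewrite mulr_ge0// addr_ge0//; apply: sumr_ge0 => i _; apply: sumr_ge0.
move=> i; rewrite mxE; apply: le_trans (ler_norm_sum _ _ _) _.
apply: (@le_trans _ _ (\sum_j `|A i j| * `|z|)).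
  by apply: ler_sum => j _; rewrite normrM ler_wpM2l// cV_coord_le.
rewrite -mulr_suml ler_wpM2r// (bigD1 i)//= addrCA lerDl addr_ge0//.
by apply: sumr_ge0 => k _; apply: sumr_ge0.
Qed.

Lemma continuous_mulmx n m (A : 'M[R]_(n, m)) : continuous (fun z : 'cV[R]_m => A *m z).
Proof.
have [C C0 AC] := mulmx_cV_bounded A.
by apply: (@continuous_of_lipschitz _ _ _ _ C) => // x y; rewrite -mulmxBr.
Qed.

(** The mean value theorem on the segment from [y] to [x], one coordinate at a time;
the segment stays in the ball because balls are convex. *)
Lemma lipschitz_of_diff_le n (f : 'cV[R]_n -> 'cV[R]_n) (L M : R) : 0 <= L ->
  (forall x, differentiable f x) ->
  (forall z h, `|z| <= M -> `|'d f z h| <= L * `|h|) ->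
  forall x y, `|x| <= M -> `|y| <= M -> `|f x - f y| <= L * `|x - y|.
Proof.
move=> L0 df fL x y xM yM; apply: cV_norm_le; first exact: mulr_ge0.
move=> i; rewrite !mxE.
pose l (t : R) := y + t *: (x - y).
have dl (t : R) : is_derive t (1 : R) l (x - y).
  have := @is_deriveD _ _ _ (cst y) (fun t : R => t *: (x - y)) t 1 0 (x - y).
  rewrite add0r; apply.
  apply: DeriveDef; first exact/derivable1_diffP.
  by rewrite deriveE// diff_val scale1r.
have dg (t : R) := is_derive_coord i (is_derive_diff_comp (dl t) (df (l t))).
have cg : {within `[0, 1], continuous (fun s => (f \o l) s i ord0)}.
  apply: continuous_subspaceT => t.
  by have /@ex_derive/derivable1_diffP/differentiable_continuous := dg t.
have [c c01] := MVT_segment ler01 (fun t _ => dg t) cg.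
have l1 : l 1 = x by rewrite /l scale1r addrC subrK.
have l0 : l 0 = y by rewrite /l scale0r addr0.
rewrite /= l1 l0 subr0 mulr1 => ->.
apply: le_trans (cV_coord_le _ _ _) _; apply: fL.
have -> : l c = c *: x + (1 - c) *: y.
  by rewrite /l scalerBr scalerBl scale1r addrCA.
move: c01; rewrite in_itv/= => /andP[c0 c1].
apply: le_trans (ler_normD _ _) _; rewrite !normrZ (ger0_norm c0) ger0_norm ?subr_ge0//.
have : c * `|x| <= c * M by rewrite ler_wpM2l.
have : (1 - c) * `|y| <= (1 - c) * M by rewrite ler_wpM2l// subr_ge0.
lra.
Qed.

End linear_and_lipschitz.

(** * Picard iteration for a globally Lipschitz field *)

Section picard.
Context {R : realType} {n : nat}.
Variables (f : R -> 'cV[R]_n -> 'cV[R]_n) (T L : R) (x : 'cV[R]_n).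
Implicit Types (u v : R -> 'cV[R]_n) (s t C : R).

(** Clamping the time makes every iterate continuous on the whole line. *)
Definition picard_step u t : 'cV[R]_n :=
  x + \col_i primitive (fun s => f s (u s) i ord0) (time_clamp T t).

Definition picard k := iter k picard_step (cst x).

Hypothesis T0 : 0 <= T.
Hypothesis L0 : 0 < L.
Hypothesis f_continuous : forall u, continuous u -> continuous (fun s => f s (u s)).
Hypothesis f_lipschitz : forall s y z, `|f s y - f s z| <= L * `|y - z|.

Lemma picard_step_continuous u : continuous u -> continuous (picard_step u).
Proof.
move=> cu; apply: continuous_cV => i.
rewrite (_ : (fun _ => _) = (fun t => x i ord0 +
    (primitive (fun s => f s (u s) i ord0) \o time_clamp T) t)); last first.
  by apply/funext => t; rewrite !mxE.
move=> t; apply: cvgD; first exact: cvg_cst.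
apply: continuous_comp_time_clamp => //; apply: primitive_continuous => //.
exact/continuous_cV_coord/f_continuous.
Qed.

Lemma picard_continuous k : continuous (picard k).
Proof.
elim: k => [|k IH] /=; first by move=> t; exact: cvg_cst.
exact: picard_step_continuous.
Qed.

(** In the weighted distance [sup_t exp (- 2 L t) |u t - v t|] the Picard map is
a contraction of ratio [1/2]. *)
Lemma picard_step_contract u v C : continuous u -> continuous v -> 0 <= C ->
  (forall s, s \in `[0, T] -> `|u s - v s| <= C * expR (2 * L * s)) ->
  forall t, t \in `[0, T] ->
    `|picard_step u t - picard_step v t| <= C / 2 * expR (2 * L * t).
Proof.
move=> cu cv C0 uv t tT.
apply: cV_norm_le => [|i]; first by rewrite mulr_ge0 ?divr_ge0 ?expR_ge0.
rewrite /picard_step time_clamp_id// !mxE.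
have cfu : continuous (fun s => f s (u s) i ord0) by exact/continuous_cV_coord/f_continuous.
have cfv : continuous (fun s => f s (v s) i ord0) by exact/continuous_cV_coord/f_continuous.
set F := primitive _; set G := primitive _.
have t0 : 0 <= t by move: tT; rewrite in_itv/= => /andP[].
have dE (s : R) : is_derive s (1 : R) (fun s => C / 2 * expR (2 * L * s)) (L * (C * expR (2 * L * s))).
  have h : is_derive s (1 : R) ( *%R (2 * L)) (2 * L).
    by have := @is_deriveZ _ _ _ id (2 * L) s 1 1 _; rewrite scaler1; apply.
  have h2 := @is_derive1_comp _ expR ( *%R (2 * L)) s _ _ (is_derive_expR (2 * L * s)) h.
  have := @is_deriveZ _ _ _ _ (C / 2) s 1 _ h2.
  rewrite /GRing.scale/= (_ : C / 2 * _ = L * (C * expR (2 * L * s)))//.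
  by field.
have := @increment_le R (fun s => F s - G s) (fun s => f s (u s) i ord0 - f s (v s) i ord0)
  (fun s => C / 2 * expR (2 * L * s)) (fun s => L * (C * expR (2 * L * s))) 0 t t0.
rewrite /F /G !primitive0 subrr subr0 mulr0 expR0 mulr1.
move=> H; apply: (le_trans (y := C / 2 * expR (2 * L * t) - C / 2)); last by rewrite gerBl divr_ge0.
rewrite (_ : _ - _ = primitive (fun s => f s (u s) i ord0) t -
  primitive (fun s => f s (v s) i ord0) t); last by ring.
apply: H.
- by move=> s; apply: continuousB; apply: primitive_continuous.
- apply: continuous_subspaceT => s.
  by have /@ex_derive/derivable1_diffP/differentiable_continuous := dE s.
- move=> s; rewrite in_itv/= => /andP[s0 _].
  by apply: is_deriveB; exact: primitive_is_derive.
move=> s; rewrite in_itv/= => /andP[s0 st].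
have := cV_coord_le (f s (u s) - f s (v s)) i ord0; rewrite !mxE => /le_trans; apply.
apply: le_trans (f_lipschitz _ _ _) _; rewrite ler_pM2l// uv//.
move: tT; rewrite !in_itv/= (ltW s0) => /andP[_ tT] /=.
exact: le_trans (ltW st) tT.
Qed.

Lemma picard_clamp k t : picard k (time_clamp T t) = picard k t.
Proof.
by case: k => [//|k]; rewrite /= /picard_step (time_clamp_id (time_clamp_in _ T0)).
Qed.

(** The increments of the iterates are bounded by a geometric series of ratio [1/2]. *)
Lemma picard_dist : exists2 C, 0 <= C & forall k p t,
  `|picard (k + p) t - picard k t| <= C * 2^-1 ^+ k.
Proof.
have [C C0 HC] : exists2 C, 0 <= C & forall t, t \in `[0, T] -> `|picard 1 t - picard 0 t| <= C.
  have [|c _ H] := @EVT_max R (fun t => `|picard 1 t - picard 0 t|) 0 T T0.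
    apply: continuous_subspaceT => t.
    by apply: cvg_norm; apply: cvgB; exact: picard_continuous.
  by exists `|picard 1 c - picard 0 c|.
have one k t : t \in `[0, T] ->
    `|picard k.+1 t - picard k t| <= C * 2^-1 ^+ k * expR (2 * L * t).
  elim: k t => [|k IH] t tT.
    rewrite expr0 mulr1; apply: le_trans (HC _ tT) _; rewrite ler_peMr//.
    rewrite -[leLHS]expR0 ler_expR mulr_ge0//; first by rewrite mulr_ge0// ltW.
    by move: tT; rewrite in_itv/= => /andP[].
  rewrite exprSr mulrA.
  apply: (@picard_step_contract (picard k.+1) (picard k)) => //.
  - exact: (@picard_continuous k.+1).
  - exact: picard_continuous.
  by rewrite mulr_ge0// exprn_ge0.
exists (2 * (C * expR (2 * L * T))).
  by rewrite mulr_ge0// mulr_ge0// expR_ge0.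
move=> k p t; set D := C * _.
have D0 : 0 <= D by rewrite mulr_ge0// expR_ge0.
suff : `|picard (k + p) t - picard k t| <= 2 * D * 2^-1 ^+ k - 2 * D * 2^-1 ^+ (k + p).
  move/le_trans; apply; rewrite gerBl mulr_ge0// ?exprn_ge0//; lra.
rewrite -picard_clamp -(picard_clamp k).
have := time_clamp_in t T0; set s := time_clamp T t => sT.
elim: p => [|p IH]; first by rewrite addn0 !subrr normr0.
rewrite addnS (_ : _ - _ = (picard (k + p).+1 s - picard (k + p) s) +
   (picard (k + p) s - picard k s)); last by rewrite addrA subrK.
apply: le_trans (ler_normD _ _) _.
have : `|picard (k + p).+1 s - picard (k + p) s| <= D * 2^-1 ^+ (k + p).
  apply: le_trans (one _ _ sT) _; rewrite /D [leRHS]mulrAC ler_wpM2l//.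
    by rewrite mulr_ge0// exprn_ge0.
  by rewrite ler_expR ler_wpM2l//; [rewrite mulr_ge0// ltW | move: sT; rewrite in_itv/= => /andP[]].
rewrite [_ ^+ (k + p).+1]exprSr; move: IH; clearbody D.
move: (2^-1 ^+ (k + p)) => y; lra.
Qed.

Lemma half_pow_cvg C : 0 <= C -> forall e, 0 < e -> \forall k \near \oo, C * 2^-1 ^+ k <= e.
Proof.
move=> C0 e e0.
have C1 : 0 < e / (C + 1) by rewrite divr_gt0//; lra.
have : (2^-1 : R) ^+ k @[k --> \oo] --> (0:R).
  by apply: cvg_expr; rewrite ger0_norm//; lra.
move/cvgrPdist_le => /(_ _ C1); apply: filterS => k.
rewrite sub0r normrN ger0_norm ?exprn_ge0// => h.
apply: (@le_trans _ _ (C * (e / (C + 1)))); first by rewrite ler_wpM2l.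
by rewrite mulrCA ger_pMr// ler_pdivrMr; lra.
Qed.

(** Besides solving the integral equation, the limit is pointwise: when [f] depends
on a parameter, the solution inherits measurability from the iterates. *)
Theorem picard_limit : exists u, [/\ continuous u,
  forall t, picard k t @[k --> \oo] --> u t
  & forall t, t \in `[0, T] -> u t = x + \col_i primitive (fun s => f s (u s) i ord0) t].
Proof.
have [C C0 HC] := picard_dist.
have cvgp t i : cvg (picard k t i ord0 @[k --> \oo]).
  apply/cauchy_cvgP/cauchy_exP => e e0.
  have [k _ Hk] := half_pow_cvg C0 (divr_gt0 e0 (ltr0Sn R 1)).
  exists (picard k t i ord0); exists k => // j /= kj.
  have := cV_coord_le (picard (k + (j - k)) t - picard k t) i ord0.
  rewrite !mxE subnKC// => h.
  rewrite /ball/= distrC; apply: le_lt_trans h _.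
  have := HC k (j - k)%N t; rewrite subnKC// => /le_lt_trans; apply.
  by apply: le_lt_trans (Hk k (leqnn k)) _; rewrite ltr_pdivrMr// ltr_pMr// ltr1n.
pose u t : 'cV[R]_n := \col_i lim (picard k t i ord0 @[k --> \oo]).
have pu t : picard k t @[k --> \oo] --> u t.
  by apply: cV_cvg => i; rewrite mxE; exact: cvgp.
have updist k t : `|u t - picard k t| <= C * 2^-1 ^+ k.
  have : (fun p => `|picard (k + p) t - picard k t|) @ \oo --> `|u t - picard k t|.
    apply: cvg_norm; apply: cvgB; last exact: cvg_cst.
    have := pu t; rewrite -(cvg_shiftn k).
    by under eq_fun do rewrite addnC.
  move=> h; rewrite -(cvg_lim _ h)//; apply: limr_le; first by apply/cvg_ex; eexists; exact: h.
  by near=> p; exact: HC.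
have cu : continuous u.
  move=> t; apply/cvgrPdist_le => e e0.
  have e3 : 0 < e / 3 by lra.
  have [k _ Hk] := half_pow_cvg C0 e3.
  have /cvgrPdist_le/(_ _ e3) := @picard_continuous k t.
  apply: (@filterS _ (nbhs t)) => s h.
  rewrite (_ : u t - u s = (u t - picard k t) + (picard k t - picard k s) - (u s - picard k s)); last first.
    by rewrite opprB !subrKA.
  apply: le_trans (ler_normB _ _) _; have := ler_normD (u t - picard k t) (picard k t - picard k s).
  have := le_trans (updist k t) (Hk k (leqnn k)); have := le_trans (updist k s) (Hk k (leqnn k)).
  lra.
exists u; split => // t tT.
suff -> : u t = picard_step u t by rewrite /picard_step time_clamp_id.
apply/eqP; rewrite -subr_eq0 -normr_eq0 eq_le normr_ge0 andbT; apply/ler_addgt0Pr => e e0.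
rewrite add0r.
have D0 : 0 <= C * (1 + expR (2 * L * T)) by rewrite mulr_ge0// addr_ge0// expR_ge0.
have [k _ Hk] := half_pow_cvg D0 e0.
rewrite (_ : _ - _ = (u t - picard k.+1 t) + (picard_step (picard k) t - picard_step u t)); last first.
  by rewrite /= addrA subrK.
apply: le_trans (ler_normD _ _) _; apply: le_trans _ (Hk k (leqnn k)).
rewrite mulrDr mulr1 mulrDl; apply: lerD.
  apply: le_trans (updist _ _) _; rewrite ler_wpM2l// exprS ger_pMl ?exprn_gt0//; lra.
have D1 : 0 <= C * 2^-1 ^+ k by rewrite mulr_ge0// exprn_ge0.
have := @picard_step_contract (picard k) u _ (@picard_continuous k) cu D1 _ t tT.
move=> h; apply: le_trans (h _) _.
  move=> s sT; rewrite distrC; apply: le_trans (updist _ _) _.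
  rewrite ler_peMr// -[leLHS]expR0 ler_expR mulr_ge0//; first by rewrite mulr_ge0// ltW.
  by move: sT; rewrite in_itv/= => /andP[].
rewrite [leRHS]mulrAC ler_pM ?expR_ge0//; first by rewrite divr_ge0.
  by rewrite ler_pdivrMr//; lra.
by rewrite ler_expR ler_wpM2l//; [rewrite mulr_ge0// ltW | move: tT; rewrite in_itv/= => /andP[]].
Unshelve. all: end_near. Qed.

End picard.

(** * Random vectors *)

Section random_vectors.
Context {R : realType} {dO : measure_display} {Omega : measurableType dO}.
Implicit Types n m : nat.

Lemma random_vector_comp n m (X : Omega -> 'cV[R]_n) (f : 'cV[R]_n -> 'cV[R]_m) :
  continuous f -> random_vector X -> random_vector (f \o X).
Proof.
move=> /continuousP cf mX.
apply: (@measurability _ _ _ (borelV R m) setT (f \o X) (@open 'cV[R]_m)) => //.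
move=> _ [U oU <-]; rewrite setTI comp_preimage -[X in measurable X]setTI.
by apply: mX => //; apply: sub_sigma_algebra; exact: cf.
Qed.

Lemma random_vector_real n (X : Omega -> 'cV[R]_n) (f : 'cV[R]_n -> R) :
  continuous f -> random_vector X -> measurable_fun [set: Omega] (f \o X).
Proof.
move=> /continuousP cf mX.
apply: (measurability _ (RGenOpens.measurableE R)) => _ [_ [a [b ->]] <-].
rewrite setTI comp_preimage -[X in measurable X]setTI.
by apply: mX => //; apply: sub_sigma_algebra; apply: cf; exact: interval_open.
Qed.

(** An open set is a countable union of boxes with rational centres, and the
preimage of a box only involves finitely many coordinates. *)
Lemma random_vectorP n (X : Omega -> 'cV[R]_n) :
  random_vector X <-> forall i, measurable_fun [set: Omega] (fun w => X w i ord0).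
Proof.
split=> [mX i|mX].
  apply: (@random_vector_real _ X (fun v : 'cV[R]_n => v i ord0)) => //.
  exact: coord_continuous.
apply: (@measurability _ _ _ (borelV R n) setT X (@open 'cV[R]_n)) => //.
move=> _ [U oU <-]; rewrite setTI.
pose box (p : 'cV[rat]_n * nat) := [set v : 'cV[R]_n | forall i, `|ratr (p.1 i ord0) - v i ord0| < p.2.+1%:R^-1].
have -> : U = \bigcup_(p in [set p | box p `<=` U]) box p.
  apply/seteqP; split => [x Ux|x [p pU] /pU//].
  have := oU; rewrite openE => /(_ _ Ux); rewrite /interior => /nbhs_ballP[e /= e0 eU].
  have [k ke] : exists k : nat, k.+1%:R^-1 < e / 2.
    have := @cvg_harmonic R; move/cvgrPdist_lt => /(_ (e / 2)).
    have e2 : 0 < e / 2 by lra.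
    move=> /(_ e2)[k _ /(_ k (leqnn k))]; rewrite /= sub0r normrN ger0_norm// => ?.
    by exists k.
  have k0 : 0 < k.+1%:R^-1 :> R by rewrite invr_gt0.
  have q i : {q : rat | `|ratr q - x i ord0| < k.+1%:R^-1}.
    apply: cid; have [|q] := @rat_in_itvoo R (x i ord0 - k.+1%:R^-1) (x i ord0 + k.+1%:R^-1).
      by move: k0; move: (k.+1%:R^-1) => r; lra.
    rewrite in_itv/= => qi; exists q; rewrite ltr_norml; move: qi.
    by move: (k.+1%:R^-1) => r; lra.
  exists (\col_i sval (q i), k); last first.
    by move=> i /=; rewrite mxE; exact: (svalP (q i)).
  move=> v /= vb; apply: eU; rewrite -ball_normE/=.
  have -> : e = e / 2 + e / 2 by lra.
  apply: (@le_lt_trans _ _ (2 * k.+1%:R^-1)).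
    apply: cV_norm_le; first by rewrite mulr_ge0// ltW.
    move=> i; rewrite !mxE; have := vb i; rewrite /= mxE; have := svalP (q i).
    move: (ratr _) => a; rewrite !ltr_norml ler_norml.
    by move: (k.+1%:R^-1) => r; lra.
  by move: ke; move: (k.+1%:R^-1) => r; lra.
rewrite preimage_bigcup bigcup_mkcond.
apply: countable_bigcupT_measurable; first exact: countableP.
move=> p; case: ifPn => _; last by [].
have -> : X @^-1` box p = \bigcap_(i in [set: 'I_n]) [set w | `|ratr (p.1 i ord0) - X w i ord0| < p.2.+1%:R^-1].
  by apply/seteqP; split => [w h i _|w h i]; apply: h.
apply: fin_bigcap_measurable; first exact: finite_finset.
move=> i _; rewrite -[X in measurable X]setTI.
apply: measurable_fun_ltr => //; apply: measurableT_comp => //.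
by apply: measurable_funB => //; exact: mX.
Qed.

Lemma random_vectorD n (X Y : Omega -> 'cV[R]_n) :
  random_vector X -> random_vector Y -> random_vector (fun w => X w + Y w).
Proof.
move=> /random_vectorP mX /random_vectorP mY; apply/random_vectorP => i.
under eq_fun do rewrite mxE; exact: measurable_funD.
Qed.

Lemma random_vectorN n (X : Omega -> 'cV[R]_n) :
  random_vector X -> random_vector (fun w => - X w).
Proof.
move=> /random_vectorP mX; apply/random_vectorP => i.
under eq_fun do rewrite mxE; exact: measurableT_comp.
Qed.

Lemma random_vector_cst n (x : 'cV[R]_n) : random_vector (fun _ : Omega => x).
Proof. by apply/random_vectorP => i; exact: measurable_cst. Qed.

Lemma random_vector_cvg n (X_ : nat -> Omega -> 'cV[R]_n) (X : Omega -> 'cV[R]_n) :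
  (forall k, random_vector (X_ k)) -> (forall w, X_ k w @[k --> \oo] --> X w) -> random_vector X.
Proof.
move=> mX cX; apply/random_vectorP => i.
apply: (@measurable_fun_cvg _ _ _ setT (fun k w => X_ k w i ord0)) => //.
  by move=> k; have /random_vectorP := mX k; exact.
by move=> w _; exact: cV_cvg_coord.
Qed.

(** Riemann sums turn an integral over time into a limit of finite sums of
random variables. *)
Lemma measurable_primitive (g : Omega -> R -> R) t : 0 <= t ->
  (forall w, continuous (g w)) ->
  (forall s, 0 <= s -> measurable_fun [set: Omega] (g ^~ s)) ->
  measurable_fun [set: Omega] (fun w => primitive (g w) t).
Proof.
move=> t0 cg mg.
apply: (@measurable_fun_cvg _ _ _ setT
  (fun n w => \sum_(k < n.+1) (t / n.+1%:R) * g w (k%:R * (t / n.+1%:R)))).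
- move=> n; apply: measurable_sum => k; apply: measurable_funM => //.
  by apply: mg; rewrite mulr_ge0// divr_ge0.
- by move=> w _; exact: riemann_sum_cvg.
Qed.

Lemma random_vector_picard n (f : Omega -> R -> 'cV[R]_n -> 'cV[R]_n) (T : R) x :
  0 <= T ->
  (forall w u, continuous u -> continuous (fun s => f w s (u s))) ->
  (forall s Y, random_vector Y -> random_vector (fun w => f w s (Y w))) ->
  forall k t, random_vector (fun w => picard (f w) T x k t).
Proof.
move=> T0 cf mf; elim=> [|k IH] t; first exact: random_vector_cst.
apply: random_vectorD; first exact: random_vector_cst.
apply/random_vectorP => i; under eq_fun do rewrite mxE.
apply: measurable_primitive.
- by have := time_clamp_in t T0; rewrite in_itv/= => /andP[].
- by move=> w; apply/continuous_cV_coord/cf; apply: (@picard_continuous _ _ _ _ x T0 _ k); exact: cf.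
by move=> s s0; have /random_vectorP := mf s _ (IH s); exact.
Qed.

End random_vectors.

(** * Pathwise theory of [X t = x + \int_0^t mu (X s) ds + g t] *)

Section integral_curves.
Context {R : realType} {n : nat}.
Implicit Types (x : 'cV[R]_n) (b w g X Y : R -> 'cV[R]_n) (mu : 'cV[R]_n -> 'cV[R]_n) (T A : R).

Record integral_curve T b w : Prop := IntegralCurve {
  curve_continuous : {within `[0, T], continuous w};
  curve_derive : forall t, t \in `]0, T[ -> is_derive t (1 : R) w (b t) }.

Definition integral_from x b t : 'cV[R]_n := x + \col_i primitive (fun s => b s i ord0) t.

Lemma integral_from0 x b : integral_from x b 0 = x.
Proof.
by apply/colP => i; rewrite !mxE primitive0 addr0.
Qed.

Lemma integral_from_curve x b T : 0 <= T -> continuous b ->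
  integral_curve T b (integral_from x b).
Proof.
move=> T0 cb; have ci i : continuous (fun s => b s i ord0) by exact: continuous_cV_coord.
have ei i : (fun s => integral_from x b s i ord0) =
    (fun s => x i ord0 + primitive (fun s => b s i ord0) s).
  by apply/funext => s; rewrite !mxE.
split.
- move=> t; apply: cV_cvg => i.
  have : {within `[0, T], continuous (fun s => integral_from x b s i ord0)}.
    rewrite ei => s; apply: cvgD; first exact: cvg_cst.
    exact: (primitive_continuous T0 (ci i)).
  exact.
- move=> t; rewrite in_itv/= => /andP[t0 _].
  apply: is_derive_cV => i; rewrite ei.
  have := @is_deriveD _ _ _ (cst (x i ord0)) (primitive (fun s => b s i ord0)) t 1 0 (b t i ord0).
  rewrite add0r; apply.
  exact: primitive_is_derive.
Qed.

(** Gronwall for the sum of the squares of the coordinates, which unlike the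
sup norm is differentiable. *)
Lemma curve_stability T L b w : 0 <= L -> integral_curve T b w ->
  (forall t, t \in `]0, T[ -> `|b t| <= L * `|w t|) ->
  forall t, t \in `[0, T] -> `|w t| <= n%:R * `|w 0| * expR (n%:R * L * t).
Proof.
move=> L0 [cw dw] bw t tT.
pose E s := \sum_(i < n) w s i ord0 ^+ 2.
have sq_le (v : 'cV[R]_n) i : v i ord0 ^+ 2 <= `|v| ^+ 2.
  by rewrite -real_normK ?num_real// lerXn2r ?nnegrE// cV_coord_le.
have E_le s : E s <= n%:R * `|w s| ^+ 2.
  rewrite /E mulr_natl -[X in _ <= _ *+ X](card_ord n) -sumr_const.
  by apply: ler_sum => i _; exact: sq_le.
have E0 s : 0 <= E s by apply: sumr_ge0 => i _; exact: sqr_ge0.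
have le_E s : `|w s| ^+ 2 <= E s.
  have : `|w s| <= Num.sqrt (E s).
    apply: cV_norm_le; first exact: sqrtr_ge0.
    move=> i; rewrite -sqrtr_sqr ler_wsqrtr// /E (bigD1 i)//= lerDl.
    by apply: sumr_ge0 => j _; exact: sqr_ge0.
  by move=> h; rewrite -[leRHS](sqr_sqrtr (E0 s)) lerXn2r ?nnegrE ?sqrtr_ge0.
pose E' s := \sum_(i < n) 2 * w s i ord0 * b s i ord0.
have EA : E t <= E 0 * expR (2 * n%:R * L * t).
  apply: (@gronwall _ E E' (2 * n%:R * L) T) => //.
  - move=> s; apply: cvg_big => [|i _]; first exact: add_continuous.
    rewrite expr2; under eq_cvg do rewrite expr2.
    by apply: cvgM; apply: cV_cvg_coord; exact: cw.
  - move=> s /dw ds; rewrite /E /E'.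
    rewrite (_ : (fun s => _) = \sum_(i < n) (fun s => w s i ord0 ^+ 2)); last first.
      by apply/funext => r; rewrite fct_sumE.
    apply: is_derive_sum => i.
    have di := is_derive_coord i ds.
    have := @is_deriveX _ _ _ 2%N s 1 _ di.
    by rewrite expr1.
  - move=> s sT; apply: (@le_trans _ _ (\sum_(i < n) 2 * (L * `|w s| ^+ 2))).
      apply: ler_sum => i _; rewrite -mulrA ler_wpM2l//.
      apply: le_trans (ler_norm _) _; rewrite normrM.
      rewrite expr2 mulrCA; apply: ler_pM => //; first exact: cV_coord_le.
      by apply: le_trans (cV_coord_le _ _ _) _; exact: bw.
    rewrite sumr_const card_ord -[leLHS]mulr_natl.
    rewrite (_ : n%:R * _ = 2 * n%:R * L * `|w s| ^+ 2); last by ring.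
    by rewrite ler_wpM2l// !mulr_ge0.
have rhs0 : 0 <= n%:R * `|w 0| * expR (n%:R * L * t) by rewrite !mulr_ge0 ?expR_ge0.
rewrite -(@ler_pXn2r _ 2) ?nnegrE//.
apply: le_trans (le_E t) _; apply: le_trans EA _.
rewrite exprMn (_ : 2 * n%:R * L * t = (n%:R * L * t) *+ 2); last by rewrite mulr2n; ring.
rewrite -mulr_natr expRM_natr ler_wpM2r ?exprn_ge0 ?expR_ge0//.
apply: le_trans (E_le 0) _; rewrite exprMn ler_wpM2r ?exprn_ge0//.
by rewrite -natrX ler_nat; case: (n) => // k; rewrite leq_pmulr.
Qed.

(** Along the curve, [V] grows at rate at most [A], and multiplying the velocity by
[c t] in [[0, 1]] preserves this because [A * V] is nonnegative. The case [c = 1] is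
the equation itself, the other cases are the equations with cut off drift. *)
Lemma curve_lyapunov T A g (c : R -> R) mu (V : 'cV[R]_n -> R) w : 0 <= A ->
  integral_curve T (fun t => c t *: mu (w t + g t)) w ->
  (forall t, 0 <= c t <= 1) ->
  (forall x, differentiable V x) -> (forall x, 0 <= V x) ->
  (forall x t, t \in `[0, T] -> 'd V x (mu (x + g t)) <= A * V x) ->
  forall t, t \in `[0, T] -> V (w t) <= V (w 0) * expR (A * t).
Proof.
move=> A0 [cw dw] c01 dV V0 VA.
apply: (@gronwall _ (V \o w) (fun t => 'd V (w t) (c t *: mu (w t + g t)))).
- move=> s; apply: (@continuous_comp (subspace `[0, T]) _ _ w V); first exact: cw.
  exact: differentiable_continuous.
- by move=> t /dw ?; exact: is_derive_diff_comp.
move=> t tT; rewrite linearZ/= /GRing.scale/=.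
have tT' : t \in `[0, T] by exact: subset_itv_oo_cc.
have /andP[c0 c1] := c01 t.
apply: (@le_trans _ _ (c t * (A * V (w t)))); first by rewrite ler_wpM2l// VA.
by rewrite ler_piMl// mulr_ge0.
Qed.

Definition cutoff (r : R) x : R := Num.min 1 (Num.max 0 (r + 1 - `|x|)).

Lemma cutoff_ge0_le1 r x : 0 <= cutoff r x <= 1.
Proof.
by rewrite /cutoff ge_min lexx/= le_min ler01/= le_max lexx.
Qed.

Lemma cutoff_id r x : `|x| <= r -> cutoff r x = 1.
Proof. move=> xr; rewrite /cutoff; apply/min_idPl; rewrite le_max; apply/orP; right; lra. Qed.

Lemma cutoff_out r x : r + 1 <= `|x| -> cutoff r x = 0.
Proof.
move=> xr; rewrite /cutoff (max_idPl _) ?subr_le0//.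
by apply/min_idPr.
Qed.

Lemma cutoff_lipschitz r x y : `|cutoff r x - cutoff r y| <= `|x - y|.
Proof.
have h : `|(r + 1 - `|x|) - (r + 1 - `|y|)| <= `|x - y|.
  rewrite (_ : _ - _ = - (`|x| - `|y|)); last by ring.
  by rewrite normrN ler_dist_dist.
have hmax (a b c : R) : `|a - b| <= c -> `|Num.max 0 a - Num.max 0 b| <= c.
  by rewrite /Num.max !ler_norml; case: ltP => ?; case: ltP => ?; lra.
have hmin (a b c : R) : `|a - b| <= c -> `|Num.min 1 a - Num.min 1 b| <= c.
  by rewrite /Num.min !ler_norml; case: ltP => ?; case: ltP => ?; lra.
exact/hmin/hmax.
Qed.

Variables (mu : 'cV[R]_n -> 'cV[R]_n) (lip : R -> R).
Hypothesis lip0 : forall r, 0 <= lip r.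
Hypothesis mu_lip : forall r x y, `|x| <= r -> `|y| <= r -> `|mu x - mu y| <= lip r * `|x - y|.

Definition cut_drift r x := cutoff r x *: mu x.

Lemma drift_continuous : continuous mu.
Proof.
apply: continuous_of_locally_lipschitz => x.
exists (lip (`|x| + 1) + 1); first by rewrite ltr_wpDl.
move=> y xy; apply: le_trans (@mu_lip (`|x| + 1) x y _ _) _.
- by rewrite lerDl.
- by have := ler_normB x (x - y); rewrite opprB addrC subrK; lra.
by rewrite ler_wpM2r// lerDl.
Qed.

Definition cut_lip r := `|mu 0| + lip (r + 1) * (r + 1) + lip (r + 1) + 1.

Lemma cut_lip_gt0 r : 0 <= r -> 0 < cut_lip r.
Proof.
move=> r0; have h := lip0 (r + 1).
have : 0 <= lip (r + 1) * (r + 1) by rewrite mulr_ge0//; lra.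
by have := normr_ge0 (mu 0); rewrite /cut_lip; lra.
Qed.

(** The product of two functions that are bounded and Lipschitz on the ball of radius
[r + 1]; outside of it the product vanishes, and if only [y] lies outside, the
increment of the cutoff alone accounts for the difference. *)
Lemma cut_drift_lipschitz r x y : 0 <= r ->
  `|cut_drift r x - cut_drift r y| <= cut_lip r * `|x - y|.
Proof.
move=> r0; have r10 : 0 <= r + 1 by lra.
pose K := `|mu 0| + lip (r + 1) * (r + 1).
have l0 := lip0 (r + 1).
have K0 : 0 <= K by rewrite addr_ge0// mulr_ge0.
have muK z : `|z| <= r + 1 -> `|mu z| <= K.
  move=> zr; have := @mu_lip (r + 1) z 0 zr _; rewrite normr0 subr0 => /(_ r10) h.
  have := ler_normD (mu 0) (mu z - mu 0); rewrite addrC subrK => /le_trans; apply.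
  by rewrite lerD2l; apply: le_trans h _; rewrite ler_wpM2l.
have dec u v : cut_drift r u - cut_drift r v =
    (cutoff r u - cutoff r v) *: mu u + cutoff r v *: (mu u - mu v).
  by rewrite scalerBl scalerBr subrKA.
have one u v : `|u| <= r + 1 -> `|cutoff r u - cutoff r v| * `|mu u| <= K * `|u - v|.
  by move=> ur; rewrite mulrC ler_pM// ?muK// cutoff_lipschitz.
have KL z : 0 <= z -> K * z <= cut_lip r * z.
  by move=> z0; rewrite ler_wpM2r// /cut_lip -/K; lra.
wlog xr : x y / `|x| <= r + 1 => [H|].
  have [xr|xr] := leP `|x| (r + 1); first exact: H.
  have [yr|yr] := leP `|y| (r + 1); first by rewrite distrC [`|x - y|]distrC; exact: H.
  by rewrite /cut_drift (cutoff_out (ltW xr)) (cutoff_out (ltW yr)) !scale0r subrr normr0 mulr_ge0// ltW// cut_lip_gt0.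
have [yr|yr] := leP `|y| (r + 1); last first.
  have := one x y xr; rewrite /cut_drift (cutoff_out (ltW yr)) scale0r !subr0 normrZ => /le_trans.
  by apply; exact: KL.
rewrite dec; apply: le_trans (ler_normD _ _) _; rewrite !normrZ.
apply: (@le_trans _ _ (K * `|x - y| + lip (r + 1) * `|x - y|)); last first.
  by rewrite -mulrDl ler_wpM2r// /cut_lip -/K; lra.
apply: lerD; first exact: one.
have /andP[c0 c1] := cutoff_ge0_le1 r y.
by rewrite ger0_norm//; apply: le_trans (mu_lip xr yr); rewrite ler_piMl.
Qed.

Definition solves T x g X := {within `[0, T], continuous X} /\
  forall t, t \in `[0, T] -> X t = integral_from x (fun s => mu (X s)) t + g t.

(** Unlike [X], the part [w = X - g] of a solution is differentiable in time, and all
estimates are made on it. *)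
Lemma solves_curve T x g X : 0 <= T -> solves T x g X ->
  exists w, [/\ w 0 = x, integral_curve T (fun t => mu (X (time_clamp T t))) w
     & forall t, t \in `[0, T] -> X t = w t + g t].
Proof.
move=> T0 [cX eX].
have cb : continuous (fun t => mu (X (time_clamp T t))).
  move=> t; apply: (@continuous_comp _ _ _ (X \o time_clamp T) mu).
    exact: continuous_comp_time_clamp.
  exact: drift_continuous.
exists (integral_from x (fun t => mu (X (time_clamp T t)))); split.
- exact: integral_from0.
- exact: integral_from_curve.
move=> t tT; rewrite eX//; congr (_ + _ + _); apply/colP => i; rewrite !mxE.
apply: eq_primitive => s; rewrite in_itv/= => /andP[s0 st].
by rewrite time_clamp_id// in_itv/= s0; move: tT; rewrite in_itv/= => /andP[_]; exact: le_trans.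
Qed.

(** The noise [g] cancels in [X - Y], which is therefore differentiable. *)
Lemma solves_stability T M x y g X Y : 0 <= T -> solves T x g X -> solves T y g Y ->
  (forall t, t \in `[0, T] -> `|X t| <= M) -> (forall t, t \in `[0, T] -> `|Y t| <= M) ->
  forall t, t \in `[0, T] -> `|X t - Y t| <= n%:R * `|x - y| * expR (n%:R * lip M * t).
Proof.
move=> T0 /(solves_curve T0)[v [v0 [cv dv] vX]] /(solves_curve T0)[w [w0 [cw dw] wY]] XM YM t tT.
have h : integral_curve T (fun t => mu (X (time_clamp T t)) - mu (Y (time_clamp T t))) (fun t => v t - w t).
  split; first by move=> s; apply: cvgB; [exact: cv | exact: cw].
  by move=> s sT; apply: is_deriveB; [exact: dv | exact: dw].
have XY s : s \in `[0, T] -> X s - Y s = v s - w s.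
  by move=> sT; rewrite vX// wY// opprD addrACA subrr addr0.
have := @curve_stability T (lip M) _ _ (lip0 M) h _ t tT.
rewrite v0 w0 XY//; apply => s sT.
have sT' : s \in `[0, T] by exact: subset_itv_oo_cc.
by rewrite time_clamp_id// -XY//; apply: mu_lip; [exact: XM | exact: YM].
Qed.

Lemma within_bounded T X : 0 <= T -> {within `[0, T], continuous X} ->
  exists M, forall t, t \in `[0, T] -> `|X t| <= M.
Proof.
move=> T0 cX; have [|c _ H] := @EVT_max R (fun t => `|X t|) 0 T T0.
  by move=> t; apply: cvg_norm; exact: cX.
by exists `|X c|.
Qed.

Lemma solves_unique T x g X Y : 0 <= T -> solves T x g X -> solves T x g Y ->
  forall t, t \in `[0, T] -> X t = Y t.
Proof.
move=> T0 sX sY t tT.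
have [M XM] := within_bounded T0 sX.1; have [M' YM] := within_bounded T0 sY.1.
have := @solves_stability T (Num.max M M') _ _ _ _ _ T0 sX sY _ _ t tT.
rewrite subrr normr0 mulr0 mul0r => h.
apply/eqP; rewrite -subr_eq0 -normr_le0; apply: h => s sT.
  by rewrite le_max XM.
by rewrite le_max YM// orbT.
Qed.

Variables (V : 'cV[R]_n -> R) (C : R).
Hypothesis V_diff : forall x, differentiable V x.
Hypothesis V0 : forall x, 0 <= V x.
Hypothesis C0 : 0 <= C.
Hypothesis norm_le_V : forall x, `|x| <= C * V x.

Lemma solves_bound T A x g X : 0 <= T -> 0 <= A ->
  (forall x t, t \in `[0, T] -> 'd V x (mu (x + g t)) <= A * V x) ->
  solves T x g X -> forall t, t \in `[0, T] -> V (X t - g t) <= V x * expR (A * T).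
Proof.
move=> T0 A0 VA /(solves_curve T0)[w [<- [cw dw] wX]] t tT.
rewrite wX// addrK.
apply: le_trans (@curve_lyapunov T A g (fun=> 1) mu V w A0 _ _ V_diff V0 VA t tT) _.
- split => // s sT; rewrite scale1r -wX; last exact: subset_itv_oo_cc.
  by rewrite -{2}(time_clamp_id (subset_itv_oo_cc sT)); exact: dw.
- by move=> s; rewrite ler01 lexx.
by rewrite ler_wpM2l// ler_expR ler_wpM2l//; move: tT; rewrite in_itv/= => /andP[].
Qed.

(** The Lyapunov bound applies to the equation with cut off drift and keeps [u + g] in
the ball of radius [r], where the cutoff equals [1]. *)
Lemma cut_curve_solves T A G x g (r : R) (u : R -> 'cV[R]_n) : 0 <= T -> 0 <= A -> continuous g ->
  (forall x t, t \in `[0, T] -> 'd V x (mu (x + g t)) <= A * V x) ->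
  (forall t, t \in `[0, T] -> `|g t| <= G) ->
  C * (V x * expR (A * T)) + G <= r ->
  continuous u ->
  (forall t, t \in `[0, T] -> u t = integral_from x (fun s => cut_drift r (u s + g s)) t) ->
  solves T x g (fun t => u t + g t).
Proof.
move=> T0 A0 cg VA gG rlarge cu eu.
have r0 : 0 <= r.
  apply: le_trans rlarge; rewrite addr_ge0//.
    by rewrite !mulr_ge0// expR_ge0.
  have := gG 0; rewrite in_itv/= lexx T0 => /(_ isT); exact: le_trans.
have ccut : continuous (cut_drift r).
  apply: (@continuous_of_lipschitz _ _ _ _ (cut_lip r)); first exact: cut_lip_gt0.
  by move=> y z; exact: cut_drift_lipschitz.
have cb : continuous (fun s => cut_drift r (u s + g s)).
  move=> s; apply: (@continuous_comp _ _ _ (fun s => u s + g s) (cut_drift r)); last exact: ccut.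
  by apply: cvgD; [exact: cu | exact: cg].
have [cw dw] := integral_from_curve x T0 cb.
set w := integral_from x _ in cw dw eu.
have wr t : t \in `[0, T] -> `|u t + g t| <= r.
  move=> tT; apply: le_trans rlarge; apply: le_trans (ler_normD _ _) _.
  apply: lerD; last exact: gG.
  apply: le_trans (norm_le_V _) _; rewrite ler_wpM2l// eu//.
  have w0 : w 0 = x by exact: integral_from0.
  rewrite -[V x](congr1 V w0).
  apply: le_trans (@curve_lyapunov T A g (fun t => cutoff r (u t + g t)) mu V w A0 _ _ V_diff V0 VA t tT) _.
  - split => // s sT; rewrite -eu; last exact: subset_itv_oo_cc.
    exact: dw.
  - by move=> s; exact: cutoff_ge0_le1.
  by rewrite ler_wpM2l// ler_expR ler_wpM2l//; move: tT; rewrite in_itv/= => /andP[].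
split; first by apply: continuous_subspaceT => t; apply: cvgD; [exact: cu | exact: cg].
move=> t tT; rewrite eu//; congr (_ + _ + _); apply/colP => i; rewrite !mxE.
apply: eq_primitive => s; rewrite in_itv/= => /andP[s0 st].
rewrite /cut_drift cutoff_id ?scale1r//; apply: wr.
by rewrite in_itv/= s0; move: tT; rewrite in_itv/= => /andP[_]; exact: le_trans.
Qed.

End integral_curves.

(** * Exponential square moments of the running maximum of a Brownian motion *)

Section chaining.
Context {R : realType}.

Definition chain_weight (k : nat) : R := (3 / 4) ^+ k / 8.

Lemma chain_weight_gt0 k : 0 < chain_weight k.
Proof. by rewrite divr_gt0// exprn_gt0//; lra. Qed.

(** Every dyadic time is reached from [0] through at most one increment of each
level, and the weights sum to [1/2]; the other times follow by continuity. *)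
Lemma chaining_le (w : R -> R) (T lam : R) : 0 < T -> 0 <= lam ->
  {within `[0, T], continuous w} ->
  (forall k j, (j < 2 ^ k)%N ->
    `|w (T * j.+1%:R / 2 ^+ k) - w (T * j%:R / 2 ^+ k)| <= chain_weight k * lam) ->
  forall t, t \in `[0, T] -> `|w t - w 0| <= lam / 2.
Proof.
move=> T0 lam0 cw wl t tT.
have p2 k : 0 < (2 : R) ^+ k by rewrite exprn_gt0.
have grid k i : (i <= 2 ^ k)%N ->
    `|w (T * i%:R / 2 ^+ k) - w 0| <= (4 - 3 * (3 / 4) ^+ k) / 8 * lam.
  elim: k i => [|k IH] i.
    rewrite expn0 expr0; case: i => [|[|//]] _.
      rewrite mulr0 mul0r subrr normr0 mulr_ge0//; lra.
    have := wl 0%N 0%N isT; rewrite expr0 mulr0 mul0r /chain_weight expr0.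
    by rewrite (_ : (4 - 3 * 1) / 8 = 1 / 8 :> R); last by lra.
  have even_pt i' : T * (i'.*2)%:R / 2 ^+ k.+1 = T * i'%:R / 2 ^+ k :> R.
    rewrite -muln2 natrM exprSr; field; exact: lt0r_neq0.
  rewrite -(odd_double_half i); move: (i./2) => i'.
  have mono : (4 - 3 * (3 / 4) ^+ k) / 8 * lam + chain_weight k.+1 * lam =
      (4 - 3 * (3 / 4) ^+ k.+1) / 8 * lam.
    by rewrite /chain_weight exprSr; move: (_ ^+ k) => z; field.
  case: (odd i) => /=.
    rewrite add1n expnS mul2n => h.
    have hi : (i' < 2 ^ k)%N by rewrite -ltn_double.
    have := wl k.+1 i'.*2; rewrite expnS mul2n => /(_ h); rewrite even_pt => h1.
    have := IH i' (ltnW hi) => h2.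
    rewrite -mono [leRHS]addrC -(subrKA (w (T * i'%:R / 2 ^+ k)) (w (T * i'.*2.+1%:R / 2 ^+ k.+1))).
    by apply: le_trans (ler_normD _ _) _; apply: lerD.
  rewrite add0n expnS mul2n leq_double even_pt => h.
  apply: le_trans (IH _ h) _; rewrite -mono lerDl mulr_ge0//.
  exact/ltW/chain_weight_gt0.
move: tT; rewrite in_itv/= => /andP[t0 tT].
pose N k := Num.truncn (2 ^+ k * (t / T)).
have Nle k : (N k)%:R <= 2 ^+ k * (t / T) < (N k).+1%:R.
  by apply: truncn_itv; rewrite mulr_ge0 ?divr_ge0// ltW.
have Nb k : (N k <= 2 ^ k)%N.
  rewrite -(ler_nat R) natrX; have /andP[h _] := Nle k; apply: le_trans h _.
  by rewrite ler_piMr ?(ltW (p2 k))// ler_pdivrMr// mul1r.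
have ucvg : T * (N k)%:R / 2 ^+ k @[k --> \oo] --> t.
  apply/cvgrPdist_le => e e0.
  have [K _ HK] := half_pow_cvg (ltW T0) e0.
  exists K => // k /HK /=; apply: le_trans.
  have -> : t - T * (N k)%:R / 2 ^+ k = T * 2^-1 ^+ k * (2 ^+ k * (t / T) - (N k)%:R).
    rewrite exprVn; field; apply/andP; split; exact: lt0r_neq0.
  have /andP[h1 h2] := Nle k.
  have D0 : 0 <= T * 2^-1 ^+ k by rewrite mulr_ge0 ?exprn_ge0// ltW.
  rewrite ger0_norm; last by rewrite mulr_ge0// subr_ge0.
  rewrite ler_piMr//.
  by move: h2; rewrite -natr1; lra.
have tin : t \in `[0, T] by rewrite in_itv/= t0.
have uin k : T * (N k)%:R / 2 ^+ k \in `[0, T].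
  rewrite in_itv/= ler_pdivrMr// ler_pM2l// -natrX ler_nat Nb andbT.
  by rewrite divr_ge0 ?mulr_ge0// ltW.
have ew : (fun k => w (T * (N k)%:R / 2 ^+ k)) =
    (fun k => (w \o time_clamp T) (T * (N k)%:R / 2 ^+ k)).
  by apply/funext => k /=; rewrite time_clamp_id.
have wcvg : `|w (T * (N k)%:R / 2 ^+ k) - w 0| @[k --> \oo] --> `|w t - w 0|.
  apply: cvg_norm; apply: cvgB; last exact: cvg_cst.
  rewrite ew -[t in w t](time_clamp_id tin).
  have ct := @continuous_comp_time_clamp R R T w (ltW T0) cw t.
  by apply: (continuous_cvg _ ct ucvg).
rewrite -(cvg_lim _ wcvg)//; apply: limr_le; first by apply/cvg_ex; eexists; exact: wcvg.
near=> k; apply: le_trans (grid k _ (Nb k)) _.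
have : 0 <= (3 / 4 : R) ^+ k by rewrite exprn_ge0//; lra.
move=> k0; rewrite [leRHS]mulrC ler_wpM2r//; lra.
Unshelve. all: end_near. Qed.

End chaining.

Section gaussian.
Context {R : realType}.
Local Notation mu := (@lebesgue_measure R).

Import HBNNSimple.

(** By definition of [normal_prob] this holds for indicators, hence for simple
functions, hence for monotone limits of these. *)
Lemma ge0_integral_normal_prob (s : R) (f : measurableTypeR R -> \bar R) :
  measurable_fun setT f -> (forall x, (0 <= f x)%E) ->
  (\int[normal_prob 0%R s]_x f x = \int[mu]_x (f x * (normal_pdf 0 s x)%:E))%E.
Proof.
move=> mf f0; set g := fun x : measurableTypeR R => (normal_pdf 0 s x)%:E.
have mg : measurable_fun setT g by apply/measurable_EFinP; exact: measurable_normal_pdf.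
have g0 x : (0 <= g x)%E by rewrite lee_fin normal_pdf_ge0.
pose h := nnsfun_approx measurableT mf.
have mh n : measurable_fun setT (fun x => (h n x)%:E).
  by apply/measurable_EFinP; exact: measurable_funP.
have hf x : (EFin \o h n) x @[n --> \oo] --> f x.
  by apply: cvg_nnsfun_approx => // y _; exact: f0.
have nd x : {homo (fun n => (h n x)%:E) : a b / (a <= b)%N >-> (a <= b)%E}.
  by move=> a b ab; rewrite lee_fin; exact/lefP/nd_nnsfun_approx.
transitivity (limn (fun n => \int[normal_prob 0%R s]_x (h n x)%:E))%E.
  rewrite -monotone_convergence//.
  - by apply: eq_integral => x _; apply/esym/cvg_lim => //; exact: hf.
  - by move=> n x _; rewrite lee_fin.
transitivity (limn (fun n => \int[mu]_x ((h n x)%:E * g x)))%E; last first.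
  rewrite -monotone_convergence//.
  - apply: eq_integral => x _; apply/cvg_lim => //.
    by apply: cvgeZr => //; exact: hf.
  - by move=> n; apply: emeasurable_funM => //; exact: mh.
  - by move=> n x _; apply: mule_ge0; [rewrite lee_fin | exact: g0].
  - by move=> x _ a b ab; apply: lee_wpmul2r => //; exact: nd.
congr (limn _); apply/funext => n.
have mi y : measurable_fun setT (fun x : measurableTypeR R => (y * \1_(h n @^-1` [set y]) x)%:E).
  by apply/measurable_EFinP; apply: measurable_funM => //; exact: measurable_indic.
transitivity (\sum_(y \in range (h n)) \int[normal_prob 0%R s]_x (y * \1_(h n @^-1` [set y]) x)%:E)%E.
  under eq_integral do rewrite fimfunE -fsumEFin//.
  rewrite ge0_integral_fsum//.
  - by move=> y x _; rewrite nnfun_muleindic_ge0.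
transitivity (\sum_(y \in range (h n)) \int[mu]_x ((y * \1_(h n @^-1` [set y]) x)%:E * g x))%E; last first.
  rewrite -ge0_integral_fsum//.
  - apply: eq_integral => x _; rewrite -ge0_mule_fsuml => [|y]; last exact: nnfun_muleindic_ge0.
    by rewrite fsumEFin// -fimfunE.
  - by move=> y; apply: emeasurable_funM => //; exact: mi.
  - by move=> y x _; rewrite mule_ge0// nnfun_muleindic_ge0.
apply: eq_fsbigr => y yh.
rewrite integralZl_indic_nnsfun// integral_indic// setIT.
under [RHS]eq_integral do rewrite EFinM -muleA.
rewrite ge0_integralZl//.
- congr (_ * _)%E; rewrite /normal_prob [LHS]integral_mkcond/=.
  apply: eq_integral => x _; rewrite patchE indicE -/(g x).
  by case: ifPn => _; rewrite ?mul1e ?mul0e.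
- by apply: emeasurable_funM => //; exact/measurable_EFinP.
- by move=> x _; rewrite mule_ge0// lee_fin.
- by move: yh; rewrite inE => -[x _ <-]; rewrite lee_fin.
Qed.

(** With [y = (x / s)^2], the integrand is at most [8^p p! exp (y / 4)], and the density
of [N(0, s^2)] times [exp (y / 4)] is [sqrt 2] times the density of [N(0, 2 s^2)]. *)
Lemma gaussian_moment (p : nat) (s : R) : 0 < s ->
  (\int[normal_prob 0%R s]_x (((x / s) ^+ 2) ^+ p * expR ((x / s) ^+ 2 / 8))%:E
    <= ((8 ^+ p * p`!%:R) * Num.sqrt 2)%:E)%E.
Proof.
move=> s0.
have mexp : measurable_fun [set: R] (fun x : R => ((x / s) ^+ 2) ^+ p * expR ((x / s) ^+ 2 / 8)).
  have m1 : measurable_fun [set: R] (fun x : R => (x / s) ^+ 2).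
    by apply: measurable_funX; apply: measurable_funM.
  apply: measurable_funM; first exact: measurable_funX.
  by apply: measurableT_comp => //; apply: measurable_funM.
rewrite ge0_integral_normal_prob; [|exact/measurable_EFinP|]; last first.
  by move=> x; rewrite lee_fin mulr_ge0 ?expR_ge0// exprn_ge0// sqr_ge0.
set s2 := Num.sqrt 2 * s.
have s20 : 0 < s2 by rewrite mulr_gt0// sqrtr_gt0.
set K := 8 ^+ p * p`!%:R.
have K0 : 0 <= K * Num.sqrt 2 by rewrite !mulr_ge0// ?exprn_ge0 ?ler0n ?sqrtr_ge0.
apply: (@le_trans _ _ (\int[mu]_x ((K * Num.sqrt 2)%:E * (normal_pdf 0 s2 x)%:E))%E); last first.
  rewrite ge0_integralZl//.
  - by rewrite integral_normal_pdf mule1.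
  - by apply/measurable_EFinP; exact: measurable_normal_pdf.
  - by move=> x _; rewrite lee_fin normal_pdf_ge0.
apply: ge0_le_integral => //.
- by move=> x _; rewrite -EFinM lee_fin !mulr_ge0 ?expR_ge0 ?normal_pdf_ge0// exprn_ge0// sqr_ge0.
- apply: emeasurable_funM; apply/measurable_EFinP => //; exact: measurable_normal_pdf.
- by apply: emeasurable_funM => //; apply/measurable_EFinP; exact: measurable_normal_pdf.
move=> x _; rewrite -!EFinM lee_fin !normal_pdfE ?gt_eqF//.
rewrite /normal_peak /normal_fun !subr0.
set y := (x / s) ^+ 2.
have y0 : 0 <= y by exact: sqr_ge0.
have e1 : - x ^+ 2 / (s ^+ 2 *+ 2) = - (y / 2).
  by rewrite /y -mulr_natr; field; rewrite gt_eqF.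
have e2 : - x ^+ 2 / (s2 ^+ 2 *+ 2) = - (y / 4).
  by rewrite /y /s2 exprMn sqr_sqrtr// -mulr_natr; field; rewrite gt_eqF.
have e3 : Num.sqrt 2 * (Num.sqrt (s2 ^+ 2 * pi *+ 2))^-1 = (Num.sqrt (s ^+ 2 * pi *+ 2))^-1.
  have -> : s2 ^+ 2 * pi *+ 2 = 2 * (s ^+ 2 * pi *+ 2).
    by rewrite /s2 exprMn sqr_sqrtr// [RHS]mulrnAr mulrA.
  by rewrite sqrtrM// invfM mulrA mulfV ?mul1r// gt_eqF// sqrtr_gt0.
have ypow : y ^+ p <= K * expR (y / 8).
  have p0 : 0 < (p`!%:R : R) by rewrite ltr0n fact_gt0.
  have : (y / 8) ^+ p / p`!%:R <= expR (y / 8).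
    case: (p) => [|q]; first by rewrite expr0 fact0 divr1 -[leLHS]expR0 ler_expR divr_ge0.
    have := @expR_ge1Dxn R (y / 8) q _; rewrite divr_ge0// => /(_ isT).
    by apply: le_trans; rewrite lerDr.
  rewrite ler_pdivrMr// exprMn exprVn ler_pdivrMr ?exprn_gt0//.
  by rewrite /K [X in _ -> _ <= X]mulrC [8 ^+ p * _]mulrC mulrA.
have split_exp : expR (- (y / 4)) = expR (y / 8) * expR (y / 8) * expR (- (y / 2)).
  by rewrite -!expRD; congr expR; lra.
rewrite e1 e2 split_exp -e3.
move: (expR (y / 8)) (expR (- (y / 2))) (expR_ge0 (y / 8)) (expR_ge0 (- (y / 2))) ypow => a b a0 b0.
have : 0 <= Num.sqrt 2 * (Num.sqrt (s2 ^+ 2 * pi *+ 2))^-1 by rewrite mulr_ge0// ?invr_ge0 sqrtr_ge0.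
move: (Num.sqrt 2) (Num.sqrt (s2 ^+ 2 * pi *+ 2))^-1 => c d cd0 yK.
rewrite [leLHS](_ : _ = y ^+ p * (a * (c * d) * b)); last by ring.
rewrite [leRHS](_ : _ = (K * a) * (a * (c * d) * b)); last by ring.
by rewrite ler_wpM2r// mulr_ge0// mulr_ge0.
Qed.

End gaussian.


Section brownian.
Context {R : realType} {dO : measure_display} {Omega : measurableType dO}.
Variables (P : probability Omega R) (m : nat) (T : R) (W : R -> Omega -> 'cV[R]_m).
Hypothesis hW : brownian_motion P T W.

Lemma measurable_brownian_coord t i : t \in `[0, T] ->
  measurable_fun [set: Omega] (fun w => W t w i ord0).
Proof. by move=> tT; have /random_vectorP := bm_process hW tT; exact. Qed.

(** One coordinate of the increment: the other coordinates are left free in the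
product formula. *)
Lemma increment_law s t i (f : measurableTypeR R -> \bar R) : 0 <= s -> s < t -> t <= T ->
  measurable_fun setT f -> (forall x, (0 <= f x)%E) ->
  (\int[P]_w f (W t w i ord0 - W s w i ord0)%R =
   \int[normal_prob 0%R (Num.sqrt (t - s))]_x f x)%E.
Proof.
move=> s0 st tT mf f0.
pose D w : measurableTypeR R := W t w i ord0 - W s w i ord0.
have mD : measurable_fun setT D.
  apply: measurable_funB; apply: measurable_brownian_coord; rewrite in_itv/= ?s0 ?tT ?andbT//=.
    exact: le_trans s0 (ltW st).
  exact: le_trans (ltW st) tT.
have := ge0_integral_pushforward mD P measurableT mf (fun y _ => f0 y).
rewrite preimage_setT => <-.
apply: eq_measure_integral => A mA _.
have mA' j : measurable (if j == i then A else setT : set R) by case: ifP.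
have := bm_normal hW s0 st tT mA'.
rewrite (bigD1 i)//= eqxx big1 => [|j /negbTE ->]; last by rewrite probability_setT.
rewrite mule1 => <-; congr (P _); apply/seteqP; split => [w Aw j|w /(_ i)].
  rewrite !mxE; case: eqP => // ->; exact: Aw.
by rewrite eqxx !mxE.
Qed.

Section positive_time.
Hypothesis T0 : 0 < T.

Definition chain_exponent : R := (8 * (64 * T))^-1.

Lemma chain_exponent_gt0 : 0 < chain_exponent.
Proof. by rewrite invr_gt0 mulr_gt0// mulr_gt0. Qed.

(** The expectation of [chain_fun k] at an increment of level [k] decays like
[(8 / 9) ^ (7 k)], where [8 / 9] is the variance factor [1 / 2] divided by the square
of the weight factor [3 / 4]. As [2 * (8 / 9) ^ 7 < 1], the
exponent [7] beats the number [2 ^ k] of increments of the level. *)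
Definition chain_fun k (x : R) : R :=
  ((x / chain_weight k) ^+ 2) ^+ 7 * expR (chain_exponent * (x / chain_weight k) ^+ 2).

Lemma chain_fun_ge0 k x : 0 <= chain_fun k x.
Proof. by rewrite mulr_ge0 ?expR_ge0// exprn_ge0// sqr_ge0. Qed.

Lemma measurable_chain_fun k : measurable_fun [set: measurableTypeR R] (chain_fun k).
Proof.
have m1 : measurable_fun [set: measurableTypeR R] (fun x : R => (x / chain_weight k) ^+ 2).
  by apply: measurable_funX; apply: measurable_funM.
apply: measurable_funM; first exact: measurable_funX.
by apply: measurableT_comp => //; apply: measurable_funM.
Qed.

Definition chain_const : R := (64 * T) ^+ 7 * ((8 ^+ 7 * 7`!%:R) * Num.sqrt 2).

Lemma chain_const_ge0 : 0 <= chain_const.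
Proof.
by rewrite /chain_const !mulr_ge0 ?exprn_ge0 ?mulr_ge0 ?ler0n ?sqrtr_ge0// ltW.
Qed.

Lemma chain_fun_expectation k s t i : 0 <= s -> t <= T -> t - s = T / 2 ^+ k ->
  (\int[P]_w (chain_fun k (W t w i ord0 - W s w i ord0))%:E <=
   (chain_const * ((8 / 9) ^+ k) ^+ 7)%:E)%E.
Proof.
move=> s0 tT tsk.
have v0 : 0 < T / 2 ^+ k by rewrite divr_gt0 ?exprn_gt0.
have st : s < t by rewrite -subr_gt0 tsk.
have sd0 : 0 < Num.sqrt (t - s) by rewrite sqrtr_gt0 subr_gt0.
have mcf : measurable_fun [set: measurableTypeR R] (EFin \o chain_fun k).
  apply/measurable_EFinP; exact: measurable_chain_fun.
rewrite (@increment_law s t i (EFin \o chain_fun k) s0 st tT mcf); last first.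
  by move=> x; rewrite lee_fin chain_fun_ge0.
set sd := Num.sqrt (t - s) in sd0 *.
set q := (8 / 9 : R) ^+ k.
have q0 : 0 <= q by rewrite exprn_ge0//; lra.
have q1 : q <= 1 by rewrite exprn_ile1//; lra.
have sq x : (x / chain_weight k) ^+ 2 = 64 * T * q * (x / sd) ^+ 2.
  rewrite !expr_div_n (_ : sd ^+ 2 = T / 2 ^+ k); last by rewrite sqr_sqrtr ?tsk// ltW.
  rewrite /chain_weight /q !expr_div_n.
  have -> : (4 : R) ^+ k = (2 ^+ k) ^+ 2 by rewrite exprAC (_ : 2 ^+ 2 = 4)//; ring.
  have -> : (8 : R) ^+ k = (2 ^+ k) ^+ 3 by rewrite exprAC (_ : 2 ^+ 3 = 8)//; ring.
  have -> : (9 : R) ^+ k = (3 ^+ k) ^+ 2 by rewrite exprAC (_ : 3 ^+ 2 = 9)//; ring.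
  have : (2 : R) ^+ k != 0 by rewrite expf_neq0.
  have : (3 : R) ^+ k != 0 by rewrite expf_neq0.
  move: (2 ^+ k) (3 ^+ k) => a b b0 a0; field.
  by rewrite a0 b0 gt_eqF.
pose c := (64 * T) ^+ 7 * q ^+ 7.
have c0 : 0 <= c by rewrite mulr_ge0 ?exprn_ge0// mulr_ge0// ltW.
pose G (x : measurableTypeR R) := ((x / sd) ^+ 2) ^+ 7 * expR ((x / sd) ^+ 2 / 8).
have mG : measurable_fun setT G.
  have m1 : measurable_fun [set: measurableTypeR R] (fun x : R => (x / sd) ^+ 2).
    by apply: measurable_funX; apply: measurable_funM.
  apply: measurable_funM; first exact: measurable_funX.
  by apply: measurableT_comp => //; apply: measurable_funM.
apply: (@le_trans _ _ (\int[normal_prob 0%R sd]_x (c%:E * (G x)%:E))%E).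
  apply: ge0_le_integral => //.
  - by move=> x _; rewrite lee_fin chain_fun_ge0.
  - by apply: emeasurable_funM => //; exact/measurable_EFinP.
  move=> x _; rewrite -EFinM lee_fin /chain_fun sq /c /G exprMn exprMn.
  rewrite -[leLHS]mulrA ler_wpM2l//.
  apply: ler_wpM2l; first by rewrite exprn_ge0// sqr_ge0.
  rewrite ler_expR.
  have gen (u v z : R) : u != 0 -> (8 * u)^-1 * (u * v * z) = v * (z / 8).
    by move=> u0; field.
  rewrite gen; last by rewrite mulf_neq0// gt_eqF.
  by rewrite ler_piMl// divr_ge0// sqr_ge0.
rewrite ge0_integralZl//; [|exact/measurable_EFinP|]; last first.
  by move=> x _; rewrite lee_fin /G mulr_ge0 ?expR_ge0// exprn_ge0// sqr_ge0.
apply: (@le_trans _ _ (c%:E * ((8 ^+ 7 * 7`!%:R) * Num.sqrt 2)%:E)%E).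
  by apply: lee_wpmul2l; [rewrite lee_fin | exact: gaussian_moment].
by rewrite -EFinM lee_fin /c /chain_const -/q mulrAC.
Qed.

Definition chain_level i k w : R :=
  \sum_(j < 2 ^ k) chain_fun k (W (T * j.+1%:R / 2 ^+ k) w i ord0 - W (T * j%:R / 2 ^+ k) w i ord0).

Lemma dyadic_in k j : (j <= 2 ^ k)%N -> T * j%:R / 2 ^+ k \in `[0, T].
Proof.
move=> jk; rewrite in_itv/= ler_pdivrMr ?exprn_gt0// ler_pM2l// -natrX ler_nat jk andbT.
by rewrite divr_ge0 ?exprn_ge0// mulr_ge0// ltW.
Qed.

Lemma measurable_chain_term i k (j : 'I_(2 ^ k)) : measurable_fun [set: Omega]
  (fun w => chain_fun k (W (T * j.+1%:R / 2 ^+ k) w i ord0 - W (T * j%:R / 2 ^+ k) w i ord0)).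
Proof.
apply: (@measurableT_comp _ _ _ _ _ _ (chain_fun k)); first exact: measurable_chain_fun.
apply: measurable_funB; apply: measurable_brownian_coord; apply: dyadic_in => //.
exact: ltnW.
Qed.

Definition chain_sum i w : \bar R := ((expR chain_exponent)%:E + \sum_(k <oo) (chain_level i k w)%:E)%E.

Lemma chain_level_ge0 i k w : 0 <= chain_level i k w.
Proof. by apply: sumr_ge0 => j _; exact: chain_fun_ge0. Qed.

Lemma measurable_chain_level i k : measurable_fun [set: Omega] (chain_level i k).
Proof. by apply: measurable_sum => j; exact: measurable_chain_term. Qed.

Lemma chain_sum_ge0 i w : (0 <= chain_sum i w)%E.
Proof.
apply: adde_ge0; first by rewrite lee_fin expR_ge0.
by apply: nneseries_ge0 => k _ _; rewrite lee_fin chain_level_ge0.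
Qed.

Lemma measurable_chain_series i :
  measurable_fun [set: Omega] (fun w => \sum_(k <oo) (chain_level i k w)%:E)%E.
Proof.
apply: ge0_emeasurable_sum => [k w _ _|k _]; first by rewrite lee_fin chain_level_ge0.
exact/measurable_EFinP/measurable_chain_level.
Qed.

Lemma measurable_chain_sum i : measurable_fun [set: Omega] (chain_sum i).
Proof. by apply: emeasurable_funD => //; exact: measurable_chain_series. Qed.

Lemma chain_sum_expectation i : (\int[P]_w chain_sum i w < +oo)%E.
Proof.
rewrite ge0_integralD//; last 2 first.
- by move=> w _; apply: nneseries_ge0 => k _ _; rewrite lee_fin chain_level_ge0.
- exact: measurable_chain_series.
apply: lte_add_pinfty; first by rewrite integral_cst//= probability_setT mule1 ltry.
rewrite integral_nneseries//; last 2 first.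
- by move=> k; exact/measurable_EFinP/measurable_chain_level.
- by move=> k w _; rewrite lee_fin chain_level_ge0.
pose rho : R := 2 * (8 / 9) ^+ 7.
have rho0 : 0 <= rho by rewrite mulr_ge0// exprn_ge0//; lra.
have rho1 : rho < 1 by rewrite /rho !exprS expr0; lra.
have level k : (\int[P]_w (chain_level i k w)%:E <= (chain_const * rho ^+ k)%:E)%E.
  under eq_integral do rewrite -sumEFin.
  rewrite ge0_integral_sum//; last 2 first.
  - by move=> j; exact/measurable_EFinP/measurable_chain_term.
  - by move=> j w _; rewrite lee_fin chain_fun_ge0.
  apply: (@le_trans _ _ (\sum_(j < 2 ^ k) (chain_const * ((8 / 9) ^+ k) ^+ 7)%:E)%E).
    apply: lee_sum => j _; apply: chain_fun_expectation.
    - by have := dyadic_in (ltnW (ltn_ord j)); rewrite in_itv/= => /andP[].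
    - by have := dyadic_in (ltn_ord j); rewrite in_itv/= => /andP[].
    - by rewrite -natr1; field; rewrite expf_neq0.
  rewrite sumEFin lee_fin sumr_const card_ord -[leLHS]mulr_natl natrX /rho.
  by rewrite [(_ ^+ k) ^+ 7]exprAC [in leRHS]exprMn mulrCA.
apply: (@le_lt_trans _ _ (chain_const / (1 - rho))%:E); last exact: ltry.
apply: lime_le.
  by apply: is_cvg_nneseries => k _ _; apply: integral_ge0 => w _; rewrite lee_fin chain_level_ge0.
near=> K; apply: (@le_trans _ _ (\sum_(0 <= k < K) (chain_const * rho ^+ k)%:E)%E).
  by apply: lee_sum => k _; exact: level.
rewrite sumEFin lee_fin -mulr_sumr ler_wpM2l ?chain_const_ge0//.
rewrite big_mkord -[leRHS]mul1r ler_pdivlMr ?subr_gt0//.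
have := subrX1 rho K; have : 0 <= rho ^+ K by rewrite exprn_ge0.
by move: (rho ^+ K) => z; lra.
Unshelve. all: end_near. Qed.

(** If [`|W t|] exceeds [1], chaining yields an increment larger than its weight times
[`|W t|], whose term in the sum is then at least [exp (chain_exponent * W t ^ 2)]. *)
Lemma chain_sum_bound w i : continuous_paths T W -> W 0 w = 0 ->
  forall t, t \in `[0, T] -> ((expR (chain_exponent * W t w i ord0 ^+ 2))%:E <= chain_sum i w)%E.
Proof.
move=> cW W0 t tT; rewrite /chain_sum.
have eps0 := chain_exponent_gt0.
have ser0 : (0 <= \sum_(k <oo) (chain_level i k w)%:E)%E.
  by apply: nneseries_ge0 => k _ _; rewrite lee_fin chain_level_ge0.
set lam := `|W t w i ord0|.
have -> : W t w i ord0 ^+ 2 = lam ^+ 2 by rewrite real_normK ?num_real.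
have lam0 : 0 <= lam by exact: normr_ge0.
have [lam1|lam1] := leP lam 1.
  apply: (@le_trans _ _ (expR chain_exponent)%:E); last by rewrite leeDl.
  by rewrite lee_fin ler_expR ler_piMr ?(ltW eps0)// exprn_ile1.
have [k [j [jk big]]] : exists k j, (j < 2 ^ k)%N /\
    chain_weight k * lam < `|W (T * j.+1%:R / 2 ^+ k) w i ord0 - W (T * j%:R / 2 ^+ k) w i ord0|.
  apply: contrapT => H.
  have cw : {within `[0, T], continuous (fun t => W t w i ord0)}.
    by move=> s; apply: cV_cvg_coord; exact: cW.
  have := chaining_le T0 lam0 cw _ tT.
  rewrite W0 mxE subr0 -/lam => h.
  have : lam <= lam / 2.
    apply: h => k j jk; rewrite leNgt; apply/negP => ?; apply: H; by exists k, j.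
  lra.
apply: (@le_trans _ _ (chain_level i k w)%:E); last first.
  rewrite -[leLHS]add0e; apply: leeD; first by rewrite lee_fin expR_ge0.
  rewrite (@nneseriesD1 _ _ k)//; last by move=> n _; rewrite lee_fin chain_level_ge0.
  by rewrite leeDl// nneseries_ge0// => n _ _; rewrite lee_fin chain_level_ge0.
rewrite lee_fin /chain_level (bigD1 (Ordinal jk))//=.
apply: ler_wpDr; first by apply: sumr_ge0 => j' _; exact: chain_fun_ge0.
set D := W _ w i ord0 - _ in big *.
have a0 := @chain_weight_gt0 R k.
have y1 : lam ^+ 2 <= (D / chain_weight k) ^+ 2.
  rewrite -(real_normK (num_real (D / chain_weight k))) lerXn2r ?nnegrE//.
  by rewrite normrM normfV (gtr0_norm a0) ler_pdivlMr// mulrC ltW.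
have y2 : 1 <= (D / chain_weight k) ^+ 2.
  by apply: le_trans y1; rewrite exprn_ege1// ltW.
rewrite /chain_fun -[leLHS]mul1r ler_pM ?expR_ge0//; first by rewrite exprn_ege1.
by rewrite ler_expR ler_pM2l.
Qed.

End positive_time.

(** The pathwise bound by the sum over all dyadic increments plays the role of a
union bound, and only the law of each single increment enters. The majorant is
extended real valued because the sum may diverge on a null set. *)
Theorem brownian_exp_moment : 0 <= T -> continuous_paths T W ->
  exists eps : R, 0 < eps /\ exists Z : Omega -> \bar R, [/\ measurable_fun setT Z,
    forall w, (0 <= Z w)%E, (\int[P]_w Z w < +oo)%E &
    {ae P, forall w, forall t, t \in `[0, T] -> ((expR (eps * `|W t w| ^+ 2))%:E <= Z w)%E}].
Proof.
rewrite le_eqVlt => /predU1P[T0 cW|T0 cW].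
  exists 1; split => //; exists (cst 1%E); split => //.
  - by rewrite integral_cst//= probability_setT mule1 ltry.
  apply: filterS (bm_start hW) => w W0 t; rewrite -T0 in_itv/= -eq_le => /eqP <-.
  by rewrite W0 normr0 expr0n/= mulr0 expR0.
exists chain_exponent; split; first exact: chain_exponent_gt0.
exists (fun w => 1 + \sum_(i < m) chain_sum i w)%E; split.
- apply: emeasurable_funD => //; apply: emeasurable_sum => i; exact: measurable_chain_sum.
- by move=> w; apply: adde_ge0 => //; apply: sume_ge0 => i _; exact: chain_sum_ge0.
- rewrite ge0_integralD//; last 2 first.
  + by move=> w _; apply: sume_ge0 => i _; exact: chain_sum_ge0.
  + by apply: emeasurable_sum => i; exact: measurable_chain_sum.
  apply: lte_add_pinfty; first by rewrite integral_cst//= probability_setT mule1 ltry.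
  rewrite ge0_integral_sum//; last 2 first.
  + by move=> i; exact: measurable_chain_sum.
  + by move=> i w _; exact: chain_sum_ge0.
  by apply: lte_sum_pinfty => i _; exact: chain_sum_expectation.
apply: filterS (bm_start hW) => w W0 t tT.
have [n0|n0] := eqVneq `|W t w| 0.
  rewrite n0 expr0n/= mulr0 expR0 leeDl//.
  by apply: sume_ge0 => i _; exact: chain_sum_ge0.
have [[i j] /= e] := mx_norm_neq0 n0.
have -> : `|W t w| = `|W t w i ord0| by rewrite -[LHS]/(mx_norm (W t w)) e (ord1 j).
rewrite real_normK ?num_real//.
apply: le_trans (chain_sum_bound T0 i cW W0 tT) _ => //.
rewrite (bigD1 i)//= addeCA leeDl// adde_ge0//.
by apply: sume_ge0 => k _; exact: chain_sum_ge0.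
Qed.

End brownian.

(** * Trading a logarithmic modulus against exponential moments *)

Section tradeoff.
Context {R : realType}.
Implicit Types (s a p q eta : R).

Lemma le_expR s : s <= expR s.
Proof. by have := expR_ge1Dx s; lra. Qed.

(** From [ln y <= y] at [y = l / (2 q + 1)]. *)
Lemma powR_le_expR q l : 0 <= q -> 0 < l -> l `^ q <= (2 * q + 1) `^ q * expR (l / 2).
Proof.
move=> q0 l0; have c0 : 0 < 2 * q + 1 by lra.
have -> : l `^ q = (2 * q + 1) `^ q * (l / (2 * q + 1)) `^ q.
  by rewrite -powRM ?divr_ge0 ?ltW// mulrC divfK// gt_eqF.
rewrite ler_wpM2l ?powR_ge0//.
have d0 : 0 < l / (2 * q + 1) by rewrite divr_gt0.
rewrite /powR gt_eqF// ler_expR.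
have h : ln (l / (2 * q + 1)) <= l / (2 * q + 1).
  have h : -1 < l / (2 * q + 1) - 1 by lra.
  by have := le_ln1Dx h; rewrite [1 + _]addrC subrK; lra.
apply: le_trans (ler_wpM2l q0 h) _.
rewrite mulrA ler_pdivrMr// [leRHS]mulrAC [q * l]mulrC -mulrA ler_pM2l//; lra.
Qed.

(** For large [s], [s ^ al = s ^ 2 * s ^ (al - 2)] and the second factor is small. *)
Lemma subquadratic a al eta : 0 <= a -> 0 <= al -> al < 2 -> 0 < eta ->
  exists2 C, 0 <= C & forall s, 0 <= s -> a * s `^ al <= C + eta * s ^+ 2.
Proof.
move=> a0 al0 al2 eta0.
pose s0 := (1 + a / eta) `^ (2 - al)^-1.
exists (a * s0 `^ al); first by rewrite mulr_ge0// powR_ge0.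
move=> s sge0; have [ss0|s0s] := leP s s0.
  apply: ler_wpDr; first by rewrite mulr_ge0 ?sqr_ge0// ltW.
  by rewrite ler_wpM2l// ge0_ler_powR// ?nnegrE// powR_ge0.
apply: ler_wpDl; first by rewrite mulr_ge0// powR_ge0.
have ae : 0 <= a / eta by rewrite divr_ge0// ltW.
have s00 : 0 < s0 by apply: powR_gt0; lra.
have spos : 0 < s by exact: lt_trans s0s.
have e : 1 + a / eta <= s `^ (2 - al).
  have -> : 1 + a / eta = s0 `^ (2 - al).
    by rewrite /s0 -powRrM mulVf ?powRr1//; [lra | rewrite gt_eqF// subr_gt0].
  by rewrite ge0_ler_powR// ?nnegrE ?ltW// subr_gt0.
have -> : s ^+ 2 = s `^ al * s `^ (2 - al).
  rewrite -powRD; last by apply/implyP => _; rewrite gt_eqF.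
  by rewrite addrC subrK powR_mulrn// ltW.
rewrite mulrCA [leLHS]mulrC ler_wpM2l ?powR_ge0//.
have : eta * (1 + a / eta) <= eta * s `^ (2 - al) by rewrite ler_pM2l.
rewrite mulrDr mulr1 mulrCA divff ?mulr1 ?gt_eqF//; lra.
Qed.

(** The a priori bound for the solution, as a function of the maximum [s] of the
Brownian motion. As [al < 2], every power of it is dominated by [exp (eta s^2)]. *)
Lemma growth_pow_le c1 c2 c3 cs al p eta : 0 <= c1 -> 0 <= c2 -> 0 <= c3 -> 0 <= cs ->
  0 <= al -> al < 2 -> 0 <= p -> 0 < eta ->
  exists2 C, 0 <= C & forall s, 0 <= s ->
    (1 + (c1 * expR (c3 * (1 + (cs * s) `^ al)) + c2 * s)) `^ p <= C * expR (eta * s ^+ 2).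
Proof.
move=> c10 c20 c30 cs0 al0 al2 p0 eta0.
have [C1 C10 H1] := @subquadratic (p * (c3 * cs `^ al)) al (eta / 2)
  (mulr_ge0 p0 (mulr_ge0 c30 (powR_ge0 _ _))) al0 al2 (divr_gt0 eta0 (ltr0Sn R 1)).
have [C2 C20 H2] := @subquadratic p 1 (eta / 2) p0 ler01 (ltr1n R 2) (divr_gt0 eta0 (ltr0Sn R 1)).
exists ((1 + c1 + c2) `^ p * expR (p * c3 + C1 + C2)).
  by rewrite mulr_ge0 ?powR_ge0 ?expR_ge0.
move=> s s0; set e := c3 * (1 + (cs * s) `^ al).
have e0 : 0 <= e by rewrite mulr_ge0// addr_ge0// powR_ge0.
have base : 1 + (c1 * expR e + c2 * s) <= (1 + c1 + c2) * expR (e + s).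
  have h1 : 1 <= expR (e + s) by rewrite -[leLHS]expR0 ler_expR addr_ge0.
  have h2 : c1 * expR e <= c1 * expR (e + s) by rewrite ler_wpM2l// ler_expR lerDl.
  have h3 : s <= expR (e + s).
    by apply: le_trans (le_expR ( s)) _; rewrite ler_expR lerDr.
  have {}h3 : c2 * s <= c2 * expR (e + s) by rewrite ler_wpM2l.
  by rewrite !mulrDl mul1r -addrA !lerD.
have b0 : 0 <= 1 + (c1 * expR e + c2 * s).
  by rewrite addr_ge0// addr_ge0// mulr_ge0// expR_ge0.
apply: (@le_trans _ _ (((1 + c1 + c2) * expR (e + s)) `^ p)).
  by rewrite ge0_ler_powR// ?nnegrE//; apply: le_trans b0 base.
rewrite powRM ?expR_ge0//; last by rewrite !addr_ge0.
rewrite -mulrA ler_wpM2l ?powR_ge0// -expRM -expRD ler_expR.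
have := H1 s s0; have := H2 s s0; rewrite powRr1//.
rewrite /e powRM//; move: (cs `^ al) (s `^ al) (s ^+ 2) => x y z; lra.
Qed.

(** With [l = - ln dl]: either [l >= 2 G], and [dl * exp G <= exp (- l / 2)] beats any
power of [l], or [l] itself is controlled by [G]. *)
Lemma log_tradeoff q dl G D M : 0 <= q -> 0 < dl -> dl < 1 -> 0 <= G -> 0 <= M -> 0 <= D ->
  D <= M -> D <= dl * expR G -> `|ln dl| `^ q * D <= (2 * q + 1) `^ q + (2 * G) `^ q * M.
Proof.
move=> q0 dl0 dl1 G0 M0 D0 DM DG.
have ln0 : ln dl < 0 by rewrite ln_lt0// dl0 dl1.
rewrite ltr0_norm//; set l := - ln dl.
have l0 : 0 < l by rewrite oppr_gt0.
have dlE : dl = expR (- l) by rewrite opprK lnK.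
have [lG|Gl] := leP l (2 * G).
  apply: ler_wpDl; first exact: powR_ge0.
  by rewrite ler_pM ?powR_ge0// ge0_ler_powR// ?nnegrE ?mulr_ge0// ltW.
apply: ler_wpDr; first by rewrite mulr_ge0// powR_ge0.
have : D <= expR (- (l / 2)).
  by apply: le_trans DG _; rewrite dlE -expRD ler_expR; lra.
move=> /(ler_wpM2l (powR_ge0 l q)) /le_trans; apply.
apply: (@le_trans _ _ ((2 * q + 1) `^ q * expR (l / 2) * expR (- (l / 2)))).
  by rewrite ler_wpM2r ?expR_ge0// powR_le_expR.
by rewrite -mulrA -expRD subrr expR0 mulr1.
Qed.

(** For [dl < 1] the two bounds on [D] are traded against each other; for [dl > 1] the
logarithm is bounded by [r]. *)
Lemma log_modulus r q kap K K1 K2 : 0 <= r -> 0 <= q -> 0 <= kap -> 0 <= K -> 0 <= K1 -> 0 <= K2 ->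
  exists2 C, 0 <= C & forall dl M D, 0 < dl -> dl != 1 -> dl <= r -> 1 <= M -> 0 <= D ->
    D <= K1 * M -> D <= K2 * dl * expR (K * M `^ kap) ->
    D <= C * M `^ (kap * q + 1) * `|ln dl| `^ (- q).
Proof.
move=> r0 q0 kap0 K0 K10 K20.
exists ((2 * q + 1) `^ q + (2 * (K2 + K)) `^ q * K1 + r `^ q * K1).
  by rewrite !addr_ge0 ?mulr_ge0 ?powR_ge0.
move=> dl M D dl0 dl1 dlr M1 D0 DM DG.
have M0 : 0 <= M by lra.
have Mp : 1 <= M `^ (kap * q + 1).
  by rewrite -[leLHS](powRr0 M) ler_powR// addr_ge0// mulr_ge0.
have lnn : 0 < `|ln dl| by rewrite normr_gt0 ln_eq0.
rewrite powRN ler_pdivlMr ?powR_gt0// mulrC.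
have MM : M `^ (kap * q) * M = M `^ (kap * q + 1).
  rewrite powRD ?powRr1//; apply/implyP => _; rewrite gt_eqF//; lra.
have Mle : M <= M `^ (kap * q + 1).
  by rewrite -[leLHS]powRr1// ler_powR// lerDr mulr_ge0.
set c1 := (2 * q + 1) `^ q; set c2 := (2 * (K2 + K)) `^ q * K1; set c3 := r `^ q * K1.
have c10 : 0 <= c1 by exact: powR_ge0.
have c20 : 0 <= c2 by rewrite mulr_ge0// powR_ge0.
have c30 : 0 <= c3 by rewrite mulr_ge0// powR_ge0.
have [dllt|dlge] := ltP dl 1; last first.
  have dlgt : 1 < dl by rewrite lt_neqAle eq_sym dl1.
  apply: (@le_trans _ _ (c3 * M `^ (kap * q + 1))); last first.
    by rewrite ler_wpM2r ?powR_ge0// lerDr addr_ge0.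
  apply: (@le_trans _ _ (r `^ q * (K1 * M))); last first.
    by rewrite mulrA ler_wpM2l.
  apply: ler_pM => //.
  rewrite ge0_ler_powR// ?nnegrE//.
  rewrite gtr0_norm ?ln_gt0//; apply: le_trans dlr.
  have h : -1 < dl - 1 by lra.
  by have := le_ln1Dx h; rewrite [1 + _]addrC subrK; lra.
pose G := (K2 + K) * M `^ kap.
have Mk : 1 <= M `^ kap by rewrite -[leLHS](powRr0 M) ler_powR.
have G0 : 0 <= G by rewrite mulr_ge0 ?powR_ge0// addr_ge0.
have DG' : D <= dl * expR G.
  apply: le_trans DG _; rewrite [K2 * dl]mulrC -mulrA ler_pM2l// /G mulrDl expRD ler_wpM2r ?expR_ge0//.
  apply: le_trans (le_expR ( K2)) _.
  by rewrite ler_expR ler_peMr.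
have := log_tradeoff q0 dl0 dllt G0 (mulr_ge0 K10 M0) D0 DM DG'.
move/le_trans; apply.
rewrite -/c1 [leRHS]mulrDl [(c1 + c2) * _]mulrDl; apply: ler_wpDr; first by rewrite mulr_ge0// powR_ge0.
apply: lerD; first by rewrite ler_peMr.
have -> : 2 * G = 2 * (K2 + K) * M `^ kap by rewrite /G mulrA.
rewrite powRM ?powR_ge0//; last by rewrite mulr_ge0// addr_ge0.
rewrite -powRrM.
by rewrite /c2 -!mulrA ler_wpM2l ?powR_ge0// mulrCA MM.
Qed.

End tradeoff.

(** * Existence, measurability and moments *)

Section sde_facts.
Context {R : realType} {d m : nat}.
Variables (T : R) (mu : 'cV[R]_d -> 'cV[R]_d) (sigma : 'M[R]_(d, m)).
Variables (dO : measure_display) (Omega : measurableType dO) (W : R -> Omega -> 'cV[R]_m).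
Hypothesis T0 : 0 <= T.
Hypothesis hWc : continuous_paths T W.

(** Clamping the time makes the noise continuous on the whole line. *)
Definition noise w t := sigma *m W (time_clamp T t) w.

Lemma noise_continuous w : continuous (noise w).
Proof.
move=> t; apply: (@continuous_comp _ _ _ ((fun t => W t w) \o time_clamp T) (fun z => sigma *m z)).
  by apply: continuous_comp_time_clamp => //; exact: hWc.
exact: continuous_mulmx.
Qed.

Lemma sde_solution_solves x Y : sde_solution T mu sigma W x Y ->
  forall w, solves mu T x (noise w) (fun t => Y t w).
Proof.
move=> [_ cY eY] w; split; first exact: cY.
by move=> t tT; rewrite eY// /noise time_clamp_id.
Qed.

Lemma solves_sde_solution x Y : (forall w, solves mu T x (noise w) (fun t => Y t w)) ->
  stochastic_process T Y -> sde_solution T mu sigma W x Y.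
Proof.
move=> sY mY; split => //; first by move=> w; exact: (sY w).1.
by move=> t w tT; rewrite (sY w).2// /noise time_clamp_id.
Qed.

End sde_facts.

Section existence.
Context {R : realType} {d m : nat}.
Variables (T : R) (mu : 'cV[R]_d -> 'cV[R]_d) (sigma : 'M[R]_(d, m)).
Variables (dO : measure_display) (Omega : measurableType dO) (W : R -> Omega -> 'cV[R]_m).
Hypothesis T0 : 0 <= T.
Hypothesis hWc : continuous_paths T W.
Hypothesis hWm : stochastic_process T W.
Variable lip : R -> R.
Hypothesis lip0 : forall r, 0 <= lip r.
Hypothesis mu_lip : forall r x y, `|x| <= r -> `|y| <= r -> `|mu x - mu y| <= lip r * `|x - y|.
Variables (V : 'cV[R]_d -> R) (C : R) (A : Omega -> R).
Hypothesis V_diff : forall x, differentiable V x.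
Hypothesis V0 : forall x, 0 <= V x.
Hypothesis C0 : 0 <= C.
Hypothesis norm_le_V : forall x, `|x| <= C * V x.
Hypothesis A0 : forall w, 0 <= A w.
Hypothesis VA : forall w x t, t \in `[0, T] -> 'd V x (mu (x + noise T sigma W w t)) <= A w * V x.

Let g w := noise T sigma W w.

(** The solution is the eventually constant limit, as the cutoff radius grows, of
the solutions of the equations with cut off drift. Each of these is a limit of Picard
iterates, hence measurable. *)
Lemma sde_existence x : exists X, sde_solution T mu sigma W x X.
Proof.
have cg w : continuous (g w) by exact: noise_continuous.
have ccut (r : nat) : continuous (cut_drift mu r%:R).
  apply: (@continuous_of_lipschitz _ _ _ _ (cut_lip mu lip r%:R)).
    exact: cut_lip_gt0.
  by move=> y z; exact: cut_drift_lipschitz.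
pose f (r : nat) w s y := cut_drift mu r%:R (y + g w s).
have fc r w u : continuous u -> continuous (fun s => f r w s (u s)).
  move=> cu s; apply: (@continuous_comp _ _ _ (fun s => u s + g w s) (cut_drift mu r%:R)).
    by apply: cvgD; [exact: cu | exact: cg].
  exact: ccut.
have fl r w s y z : `|f r w s y - f r w s z| <= cut_lip mu lip r%:R * `|y - z|.
  have := cut_drift_lipschitz lip0 mu_lip (y + g w s) (z + g w s) (ler0n R r).
  by rewrite opprD addrACA subrr addr0.
have ex r w := picard_limit x T0 (cut_lip_gt0 mu lip0 (ler0n R r)) (fc r w) (fl r w).
pose u r w := sval (cid (ex r w)).
have u_cont r w : continuous (u r w) by rewrite /u; case: cid => ? [].
have u_cvg r w t : picard (f r w) T x k t @[k --> \oo] --> u r w t.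
  by rewrite /u; case: cid => ? [].
have u_eq r w t : t \in `[0, T] ->
    u r w t = integral_from x (fun s => cut_drift mu r%:R (u r w s + g w s)) t.
  by rewrite /u; case: cid => ? [_ _ h] /=; exact: h.
have mg t : random_vector (fun w => g w t).
  apply: (@random_vector_comp _ _ _ _ _ (W (time_clamp T t)) (fun z => sigma *m z)).
    exact: continuous_mulmx.
  by apply: hWm; exact: time_clamp_in.
have mu_ r t : random_vector (fun w => u r w t).
  apply: random_vector_cvg (fun w => u_cvg r w t) => k.
  apply: random_vector_picard => //; first exact: fc.
  move=> s Y mY.
  apply: (@random_vector_comp _ _ _ _ _ (fun w => Y w + g w s) _ (ccut r)).
  exact: random_vectorD.
have large w : exists r0, forall r, (r0 <= r)%N -> solves mu T x (g w) (fun t => u r w t + g w t).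
  have [G HG] := within_bounded T0 (continuous_subspaceT (cg w)).
  exists (Num.trunc (C * (V x * expR (A w * T)) + G)).+1 => r rr.
  have hr : C * (V x * expR (A w * T)) + G <= r%:R.
    by apply: le_trans (ltW (truncnS_gt _)) _; rewrite ler_nat.
  exact: (cut_curve_solves lip0 mu_lip V_diff V0 C0 norm_le_V T0 (A0 w) (cg w) (@VA w) HG hr
    (@u_cont r w) (u_eq r w)).
(* From the radius r0 w on, all cut off equations have the same solution. *)
pose r0 w := sval (cid (large w)).
have r0P w r : (r0 w <= r)%N -> solves mu T x (g w) (fun t => u r w t + g w t).
  by rewrite /r0; case: cid => r1 h /=; exact: h.
exists (fun t w => u (r0 w) w t + g w t).
apply: solves_sde_solution; first by move=> w; exact: r0P.
move=> t tT; apply: random_vectorD (mg t).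
apply: (@random_vector_cvg _ _ _ _ (fun r w => u r w t)) => // w.
apply: cvg_near_cst; exists (r0 w) => // r /= rr.
have := solves_unique lip0 mu_lip T0 (r0P w r rr) (r0P w _ (leqnn _)) tT.
exact: addIr.
Qed.

End existence.

Theorem theorem1p1 (R : realType) (d m : nat) (hd : (0 < d)%N) (hm : (0 < m)%N)
  (T kappa : R) (hT : 0 <= T) (hkappa : 0 <= kappa)
  (alpha : R) (halpha0 : 0 <= alpha) (halpha2 : alpha < 2)
  (mu : 'cV[R]_d -> 'cV[R]_d) (hmu : C1 mu)
  (sigma : 'M[R]_(d, m))
  (V : 'cV[R]_d -> R) (hV : C1 V) (hV0 : forall x, 0 <= V x)
  (N : 'cV[R]_d -> R) (hN : is_norm N)
  (Nstar : 'cV[R]_m -> R) (hNstar : is_norm Nstar)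
  (hmu' : forall x h : 'cV[R]_d,
     N ('d mu x h) <= kappa * (1 + N x `^ kappa) * N h)
  (hV' : forall (x : 'cV[R]_d) (z : 'cV[R]_m),
     'd V x (mu (x + sigma *m z)) <= kappa * (1 + Nstar z `^ alpha) * V x)
  (hNV : forall x : 'cV[R]_d, N x <= V x)
  (dO : measure_display) (Omega : measurableType dO) (P : probability Omega R)
  (W : R -> Omega -> 'cV[R]_m)
  (hW : brownian_motion P T W) (hWc : continuous_paths T W) :
  exists X : 'cV[R]_d -> R -> Omega -> 'cV[R]_d,
    [/\ forall x, sde_solution T mu sigma W x (X x),
        forall Y : 'cV[R]_d -> R -> Omega -> 'cV[R]_d,
          (forall x, sde_solution T mu sigma W x (Y x)) ->
          forall x t w, t \in `[0, T] -> Y x t w = X x t w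
      & forall r q : R, 0 <= r -> 0 <= q ->
          exists2 c : R, 0 < c &
            forall x y : 'cV[R]_d, N x <= r -> N y <= r ->
              0 < N (x - y) -> N (x - y) != 1 ->
              (ereal_sup [set 'E_P[fun w => N (X x t w - X y t w)%R]
                         | t in `[0%R, T]]
               <= (c * `|ln (N (x - y))| `^ (- q))%:E)%E].
Proof.
have V_diff := hV.1; have mu_diff := hmu.1.
have [CN1 CN10 NC1] := is_norm_le_sup hN.
have [CN2 CN20 NC2] := is_norm_ge_sup hN.
have [CS CS0 NCS] := is_norm_le_sup hNstar.
have [Cg Cg0 NCg] := mulmx_cV_bounded sigma.
have N0 := is_norm_ge0 hN; have Ns0 := is_norm_ge0 hNstar.
(* The bound on the derivative of mu, moved from N to the sup norm. *)
pose lip r := CN2 * (kappa * (1 + (CN1 * r) `^ kappa)) * CN1.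
have lip0 r : 0 <= lip r.
  by rewrite !mulr_ge0 ?addr_ge0 ?powR_ge0// ltW.
have mu_lip r x y : `|x| <= r -> `|y| <= r -> `|mu x - mu y| <= lip r * `|x - y|.
  move=> xr yr; apply: lipschitz_of_diff_le xr yr => // z h zr.
  apply: le_trans (NC2 _) _; rewrite /lip -!mulrA ler_pM2l//.
  apply: le_trans (hmu' _ _) _; rewrite -mulrA ler_wpM2l//.
  apply: ler_pM => //; first by rewrite addr_ge0 ?powR_ge0.
  rewrite lerD2l ge0_ler_powR// ?nnegrE//.
    by rewrite mulr_ge0 ?(ltW CN10)//; exact: le_trans (normr_ge0 z) zr.
  by apply: le_trans (NC1 _) _; rewrite ler_pM2l.
have norm_le_V x : `|x| <= CN2 * V x.
  by apply: le_trans (NC2 _) _; rewrite ler_pM2l.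
have path_max w : exists2 c, c \in `[0, T] & forall t, t \in `[0, T] -> `|W t w| <= `|W c w|.
  apply: (@EVT_max R (fun t => `|W t w|) 0 T hT) => t.
  by apply: cvg_norm; exact: hWc.
(* S w is the maximum of |W t w| over [0, T]; attaining it at the time tmax w makes the almost
   sure bound by Z, which holds at all times, a bound for S w. *)
pose tmax w := sval (cid2 (path_max w)).
have tmaxT w : tmax w \in `[0, T] by rewrite /tmax; case: cid2.
pose S w := `|W (tmax w) w|.
have WS w t : t \in `[0, T] -> `|W t w| <= S w.
  by rewrite /S /tmax; case: cid2 => c _ h /=; exact: h.
have S0 w : 0 <= S w by exact: normr_ge0.
pose A w := kappa * (1 + (CS * S w) `^ alpha).
have A0 w : 0 <= A w by rewrite mulr_ge0// addr_ge0// powR_ge0.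
have VA w x t : t \in `[0, T] -> 'd V x (mu (x + noise T sigma W w t)) <= A w * V x.
  move=> tT; apply: le_trans (hV' _ _) _; rewrite ler_wpM2r// ler_wpM2l// lerD2l.
  rewrite ge0_ler_powR// ?nnegrE//; first by rewrite mulr_ge0// ltW.
  rewrite time_clamp_id//; apply: le_trans (NCS _) _.
  by rewrite ler_pM2l// WS.
have ex x := sde_existence hT hWc (bm_process hW) lip0 mu_lip V_diff hV0 (ltW CN20)
  norm_le_V A0 VA x.
pose X x := sval (cid (ex x)).
have XP x : sde_solution T mu sigma W x (X x) by rewrite /X; case: cid.
have Xs x w := sde_solution_solves (XP x) w.
exists X; split => //.
  move=> Y hY x t w tT.
  exact: (solves_unique lip0 mu_lip hT (sde_solution_solves (hY x) w) (Xs x w)).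
move=> r q r0 q0.
have [eps [eps0 [Z [mZ Z0 Zfin ZW]]]] := brownian_exp_moment hW hT hWc.
have cV : continuous V by move=> x; exact: differentiable_continuous.
have [Vr Vr0 HVr] := continuous_bounded_on_ball (CN2 * r) cV.
(* M (S w) bounds all solutions started in the ball of radius r. *)
pose M s := 1 + (CN2 * Vr * expR (kappa * T * (1 + (CS * s) `^ alpha)) + Cg * s).
have M1 s : 0 <= s -> 1 <= M s.
  by move=> s0; rewrite lerDl addr_ge0 ?mulr_ge0 ?expR_ge0// ltW.
have XM x : N x <= r -> forall w t, t \in `[0, T] -> `|X x t w| <= M (S w).
  move=> xr w t tT; rewrite -(subrK (noise T sigma W w t) (X x t w)).
  apply: le_trans (ler_normD _ _) _; apply: ler_wpDl => //; apply: lerD.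
    apply: le_trans (norm_le_V _) _; rewrite -mulrA ler_pM2l//.
    apply: le_trans (solves_bound lip0 mu_lip V_diff hV0 hT (A0 w) (@VA w) (Xs x w) tT) _.
    rewrite mulrAC -/(A w); apply: ler_pM => //; rewrite ?expR_ge0//.
    apply: le_trans (ler_norm _) _; apply: HVr; apply: le_trans (NC2 _) _.
    by rewrite ler_pM2l.
  rewrite /noise time_clamp_id//; apply: le_trans (NCg _) _.
  by rewrite ler_pM2l// WS.
(* K bounds the Gronwall exponent: d * lip (M s) * T <= K * M s `^ kappa as M s >= 1. *)
pose K := d%:R * (CN2 * kappa * (1 + CN1 `^ kappa) * CN1) * T.
have K0 : 0 <= K by rewrite !mulr_ge0 ?addr_ge0 ?powR_ge0// ltW.
have K10 : 0 <= 2 * CN1 by rewrite mulr_ge0// ltW.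
have K20 : 0 <= CN1 * d%:R * CN2 by rewrite !mulr_ge0// ltW.
have r20 : 0 <= 2 * r by rewrite mulr_ge0.
have [B1 B10 HB1] := log_modulus r20 q0 hkappa K0 K10 K20.
have p0 : 0 <= kappa * q + 1 by rewrite addr_ge0// mulr_ge0.
have [B2 B20 HB2] := growth_pow_le (mulr_ge0 (ltW CN20) Vr0) (ltW Cg0) (mulr_ge0 hkappa hT)
  (ltW CS0) halpha0 halpha2 p0 eps0.
(* Adding 1 makes the constant positive. *)
exists (B1 * B2 * fine (\int[P]_w Z w) + 1).
  by rewrite ltr_wpDl// !mulr_ge0// fine_ge0// integral_ge0.
move=> x y xr yr dl0 dl1.
have dlr : N (x - y) <= 2 * r.
  by have := is_normD hN x (- y); rewrite (is_normN hN); lra.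
have pathwise w t : t \in `[0, T] -> N (X x t w - X y t w) <=
    B1 * B2 * `|ln (N (x - y))| `^ (- q) * expR (eps * S w ^+ 2).
  move=> tT; have Ms := M1 _ (S0 w).
  have Ms0 : 0 <= M (S w) by lra.
  have D1 : N (X x t w - X y t w) <= 2 * CN1 * M (S w).
    apply: le_trans (NC1 _) _; rewrite [2 * CN1]mulrC -mulrA ler_pM2l//.
    apply: le_trans (ler_normB _ _) _.
    by have := XM x xr w t tT; have := XM y yr w t tT; lra.
  have D2 : N (X x t w - X y t w) <= CN1 * d%:R * CN2 * N (x - y) * expR (K * M (S w) `^ kappa).
    have := solves_stability lip0 mu_lip hT (Xs x w) (Xs y w) (XM x xr w) (XM y yr w) tT.
    move=> h; apply: le_trans (NC1 _) _; rewrite -!mulrA ler_pM2l//.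
    apply: le_trans h _; rewrite -mulrA ler_wpM2l// mulrA.
    apply: ler_pM => //; rewrite ?expR_ge0//.
    rewrite ler_expR; move: tT; rewrite in_itv/= => /andP[t0 tT].
    have lipM : lip (M (S w)) <= CN2 * kappa * (1 + CN1 `^ kappa) * CN1 * M (S w) `^ kappa.
      have Mk : 1 <= M (S w) `^ kappa by rewrite -[leLHS](powRr0 (M (S w))) ler_powR.
      rewrite /lip powRM ?(ltW CN10)//.
      move: (CN1 `^ kappa) (powR_ge0 CN1 kappa) (M (S w) `^ kappa) Mk => a a0 b b1.
      rewrite [leLHS](_ : _ = CN2 * kappa * CN1 * (1 + a * b)); last by ring.
      rewrite [leRHS](_ : _ = CN2 * kappa * CN1 * (b + a * b)); last by ring.
      by rewrite ler_wpM2l ?lerD2r// !mulr_ge0// ltW.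
    rewrite [leRHS](_ : _ = d%:R * (CN2 * kappa * (1 + CN1 `^ kappa) * CN1 * M (S w) `^ kappa) * T);
      last by rewrite /K; ring.
    by apply: ler_pM => //; [rewrite mulr_ge0 | rewrite ler_wpM2l].
  have := HB1 _ _ _ dl0 dl1 dlr Ms (N0 _) D1 D2.
  move/le_trans; apply.
  rewrite [leRHS]mulrAC ler_wpM2r ?powR_ge0// -[leRHS]mulrA ler_wpM2l//.
  exact: HB2.
apply: ge_ereal_sup => _ [t tT <-]; rewrite unlock.
have tT' : t \in `[0, T] by [].
set L := `|ln _| `^ _ in pathwise *.
have L0 : 0 <= L by exact: powR_ge0.
have CL0 : 0 <= B1 * B2 * L by rewrite !mulr_ge0.
apply: (@le_trans _ _ (\int[P]_w ((B1 * B2 * L)%:E * Z w))%E).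
  apply: ae_ge0_le_integral => //.
  - by move=> w _; rewrite lee_fin.
  - apply/measurable_EFinP.
    apply: (@random_vector_real _ _ _ _ (fun w => X x t w - X y t w) N).
      exact: is_norm_continuous.
    apply: random_vectorD; first exact: (sol_process (XP x)).
    apply: random_vectorN; exact: (sol_process (XP y)).
  - by move=> w _; rewrite mule_ge0// lee_fin.
  - by apply: emeasurable_funM.
  apply: filterS ZW => w HZ _.
  apply: (@le_trans _ _ ((B1 * B2 * L)%:E * (expR (eps * S w ^+ 2))%:E)%E).
    by rewrite -EFinM lee_fin pathwise.
  by apply: lee_wpmul2l; [rewrite lee_fin | exact: HZ].
rewrite ge0_integralZl//.
have F0 : 0 <= fine (\int[P]_w Z w) by rewrite fine_ge0// integral_ge0.
rewrite -[X in (_ * X <= _)%E]fineK; last by rewrite ge0_fin_numE// integral_ge0.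
rewrite -EFinM lee_fin mulrAC mulrDl mul1r.
by rewrite lerDl.
Qed.
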